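(* Let $p$ be a prime, let $e\geq 1$, and let $G$ be a finite abelian $p$-group with $\exp(G)=p^n$. Then there is a subgroup $\mathfrak{L}$ of $V(\mathbb{Z}_{p^e}G)$ such that $V(\mathbb{Z}_{p^e}G)=G\times \mathfrak{L}$ and \[ \mathfrak{L}\cong l\,C_{p^{e-1}}\times \Big(\times_{i=1}^{n} s_{i}\, C_{p^{i+e-1}}\Big), \] where, for $i=1,\dots,n$, the nonnegative integer $s_i$ equals \[ \big(|G^{p^{i-1}}|-2|G^{p^{i}}|+|G^{p^{i+1}}|\big)-t_i, \] with $t_i$ the number of cyclic direct factors of order $p^i$ in a decomposition of $G$ as a direct product of cyclic groups, and where $l=|G|-1-(s_1+\cdots+s_n)$. (Here $kC_m$ denotes the direct product of $k$ copies of the cyclic group $C_m$ of order $m$.)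
   Context: $\mathbb{Z}_{p^e}$ is the ring of residues modulo $p^e$; $V(\mathbb{Z}_{p^e}G)$ is the group of normalized units (units of augmentation $1$) of the group ring $\mathbb{Z}_{p^e}G$. For an abelian group $G$, $G^{p^k}=\{g^{p^k}: g\in G\}$. *)

(* Defs.v *)
From HB Require Import structures.
From mathcomp Require Import all_boot all_order all_algebra all_fingroup all_solvable.
Set Implicit Arguments. Unset Strict Implicit. Unset Printing Implicit Defensive.
Import GRing.Theory.

(* Model of the group ring R G (G a finite group) through its (faithful)
   right-regular representation: the basis of R^#|G| is indexed by the
   elements of G listed in  enum G, and g acts by e_h |-> e_(h*g). *)
Section GroupRing.
Variables (gT : finGroupType) (G : {set gT}) (R : comUnitRingType).
Local Open Scope ring_scope.

Definition gelt (i : nat) : gT := nth 1%g (enum G) i.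

Definition regmx (g : gT) : 'M[R]_(#|G|.-1.+1) :=
  \matrix_(i, j) ((gelt j == (gelt i * g)%g)%:R).

Definition grelt (a : {ffun gT -> R}) : 'M[R]_(#|G|.-1.+1) :=
  \sum_(g in G) a g *: regmx g.
End GroupRing.

Section NormalizedUnits.
Variables (gT : finGroupType) (G : {set gT}) (m : nat).
Local Open Scope ring_scope.

Definition Vunits : {set {'GL_#|G|['Z_m]}} :=
  [set u : {'GL_#|G|['Z_m]} | [exists a : {ffun gT -> 'Z_m},
     (\sum_(g in G) a g == 1) && (GLval u == grelt G a)]].

Definition Gcopy : {set {'GL_#|G|['Z_m]}} :=
  [set u : {'GL_#|G|['Z_m]} | [exists g in G, GLval u == regmx G 'Z_m g]].
End NormalizedUnits.

Definition powset (gT : finGroupType) (G : {set gT}) (k : nat) : {set gT} :=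
  [set (x ^+ k)%g | x in G].

(* Main.v *)
(* Let q = p^e, V the group of normalized units of (Z/q)G, and U <= V the units
   congruent to 1 modulo p.  Units are lifted to elements of augmentation 1 of
   the integral group ring ZG.  Modulo p the Frobenius identity
   (sum a_g g)^(p^k) = sum a_g g^(p^k) gives #|(V/U)^(p^k)| = p^(#|G^(p^k)| - 1)
   and shows that G is pure in V/U, so V = G x L for some L containing U.

   The key point is that L is not larger than expected: if v^p = 1 mod p^2, then
   v = g mod p for some g in G.  This is proved by descent along a chain of
   subgroups H of G: if H has index p in K, c generates K/H and v = g mod p in
   Z[G/K], then v = g (1 + (c - 1) w) in F_p[G/H]; comparing the expansions of
   (1 + (c - 1) w)^p and of c^p modulo p^2 gives w = w^p modulo c - 1, so w is a
   constant m modulo c - 1, and g c^m is the right representative in Z[G/H].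

   Hence the rank of L is at most #|G| - 1, which is the rank of U, a homocyclic
   group of exponent p^(e-1).  So U is exactly the kernel of the p^(e-1)-th power
   map on L, each invariant of L is at least p^(e-1), and dividing them by
   p^(e-1) gives the invariants of L/U, i.e. those of V/U without those of G. *)
Require Import Defs.
From mathcomp Require Import all_boot all_order all_algebra all_fingroup all_solvable.
From mathcomp Require Import ring zify.
From HB Require Import structures.
Import GRing.Theory.
Set Implicit Arguments. Unset Strict Implicit. Unset Printing Implicit Defensive.

(** * Pure and homocyclic subgroups of finite abelian p-groups *)

Local Open Scope group_scope.

Section PureSubgroups.
Variables (gT : finGroupType) (p : nat) (A B : {group gT}).
Hypotheses (abA : abelian A) (pA : p.-group A) (sBA : B \subset A).
Hypothesis pureB : forall k a, a \in A -> a ^+ (p ^ k) \in B ->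
  exists2 b, b \in B & a ^+ (p ^ k) = b ^+ (p ^ k).

Let nBA : A \subset 'N(B).
Proof. by apply: sub_abelian_norm. Qed.

(* By purity every coset contains an element of the same order as the coset. *)
Lemma pure_lift (x : coset_of B) : x \in A / B ->
  exists a, [/\ a \in A, coset B a = x & a ^+ #[x] = 1].
Proof.
case/morphimP=> a Na Aa Dx; have px : p.-elt x.
  by rewrite Dx; apply: morph_p_elt => //; apply: mem_p_elt Aa.
have [k Dk] := p_natP px.
have : coset B (a ^+ (p ^ k)) = 1 by rewrite morphX // -Dx -Dk expg_order.
move/coset_idr; rewrite groupX // => /(_ isT) Bak.
have [b Bb Eb] := pureB Aa Bak; have Ab := subsetP sBA b Bb.
exists (a * b^-1); split; first by rewrite groupM ?groupV.
  by rewrite morphM ?groupV ?(subsetP nBA) //= [X in _ * X]coset_id ?groupV ?mulg1.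
rewrite Dk expgMn; last by apply: (centsP abA); rewrite ?groupV.
by rewrite expgVn Eb mulgV.
Qed.

(** A basis of [A / B] lifts to elements of the same orders. The subgroup [L] they generate covers
    [A / B] and has at most as many elements, so counting forces [B :&: L] to be trivial. *)
Lemma pure_complement : exists L : {group gT}, B \x L = A.
Proof.
have abQ : abelian (A / B) by apply: quotient_abelian.
have [s Ds _] := abelian_structure abQ.
pose P x a := [&& a \in A, coset B a == x & a ^+ #[x] == 1].
pose f x := odflt 1 [pick a | P x a].
have fP x : x \in A / B -> P x (f x).
  move=> Qx; rewrite /f; case: pickP => //= no_a.
  have [a [Aa Da a1]] := pure_lift Qx; have /negP[] := no_a a.
  by rewrite /P Aa Da a1 !eqxx.
have sQ x : x \in s -> x \in A / B.
  move=> sx; have := bigdprodWY Ds; rewrite (big_rem x) //= => <-.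
  by rewrite mem_gen // inE cycle_id.
have [L [sLA leL Lf]] : exists L : {group gT}, [/\ L \subset A,
    #|L| <= \prod_(x <- s) #[x] & {in s, forall x, f x \in L}].
  elim: s sQ {Ds} => [|x s IHs] sQ.
    by exists 1%G; split; rewrite ?sub1G ?cards1 ?big_nil.
  have [|L [sLA leL Lf]] := IHs; first by move=> y sy; apply: sQ; rewrite inE sy orbT.
  have /and3P[Af _ f1] := fP x (sQ x (mem_head x s)).
  have sfA : <[f x]> \subset A by rewrite cycle_subG.
  exists (<[f x]> <*> L)%G; split; first by rewrite join_subG sfA.
    rewrite big_cons /= cent_joinEl ?(sub_abelian_cent2 abA) //.
    apply: (@leq_trans (#|<[f x]>| * #|L|)).
      by rewrite mul_cardG leq_pmulr // cardG_gt0.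
    by rewrite leq_mul // dvdn_leq // order_dvdn.
  move=> y; rewrite inE => /predU1P[-> | /Lf]; first by rewrite mem_gen // inE cycle_id.
  by apply: subsetP; apply: joing_subr.
have LBQ : L / B = A / B.
  apply/eqP; rewrite eqEsubset quotientS //= -(bigdprodWY Ds) gen_subG.
  rewrite big_tnth; apply/bigcupsP=> i _; rewrite cycle_subG.
  have sx : tnth (in_tuple s) i \in s by apply: mem_tnth.
  have /and3P[_ /eqP Dx _] := fP _ (sQ _ sx).
  by rewrite -[tnth _ i]Dx mem_quotient ?Lf.
have nBL : L \subset 'N(B) := subset_trans sLA nBA.
have DA : B * L = A.
  apply/eqP; rewrite eqEsubset mul_subG //= -quotientSK // LBQ //.
exists L; rewrite dprodE ?(sub_abelian_cent2 abA) //.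
have cQ : #|A / B| = (\prod_(x <- s) #[x])%N.
  by rewrite -(bigdprod_card Ds).
have cA : #|A| = (#|A / B| * #|B|)%N by rewrite card_quotient // mulnC Lagrange.
have := mul_cardG B L; rewrite DA cA => E.
apply/trivgP; rewrite subG1 trivg_card_le1.
rewrite -(leq_pmul2l (cardG_gt0 A)) muln1 cA -E mulnC leq_mul // cQ //.
Qed.
End PureSubgroups.

(** * Abelian p-groups with a large homocyclic subgroup *)

Section HomocyclicSubgroup.
Variables (gT : finGroupType) (p d N : nat) (L U : {group gT}).
Hypotheses (p_pr : prime p) (abL : abelian L) (pL : p.-group L) (sUL : U \subset L).
Hypotheses (cardU : #|U| = (p ^ (d * N))%N) (expU : {in U, forall u, u ^+ (p ^ d) = 1}).
Hypothesis rankL : #|'Ohm_1(L)| <= p ^ N.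

Lemma OhmP k x : reflect (x \in L /\ x ^+ (p ^ k) = 1) (x \in 'Ohm_k(L)).
Proof.
rewrite (OhmEabelian pL) ?(abelianS (Ohm_sub _ _)) // !inE.
by apply: (iffP andP) => -[Lx /eqP].
Qed.

Lemma card_OhmE k : #|'Ohm_k(L)| = (p ^ logn p #|'Ohm_k(L)|)%N.
Proof. by apply: card_pgroup; apply: pgroupS (Ohm_sub _ _) pL. Qed.

Lemma logn_Ohm_Mho k :
  (logn p #|'Ohm_k(L)| + logn p #|'Mho^k(L)| = logn p #|L|)%N.
Proof. by rewrite -(mul_card_Ohm_Mho_abelian k abL) lognM ?cardG_gt0. Qed.

Section Basis.
Variable b : seq gT.
Hypotheses (Db : \big[dprod/1]_(x <- b) <[x]> = L) (sizeb : size b <= N).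
Let c k := count [pred x | logn p #[x] > k] b.

Lemma count_Ohm k : (logn p #|'Ohm_k.+1(L)| = c k + logn p #|'Ohm_k(L)|)%N.
Proof.
rewrite /c (count_logn_dprod_cycle p k Db) -divgS ?Ohm_leq //.
have s_k : 'Ohm_k(L) \subset 'Ohm_k.+1(L) by apply: Ohm_leq.
by rewrite logn_div ?cardSg // subnK // dvdn_leq_log ?cardSg ?cardG_gt0.
Qed.

(** The orders of ['Ohm_k(L)] and ['Mho^k(L)] have a product independent of [k], so one loses what
    the other gains. *)
Lemma count_Mho k : (logn p #|'Mho^k(L)| = c k + logn p #|'Mho^k.+1(L)|)%N.
Proof.
apply: (@addnI (logn p #|'Ohm_k(L)|)).
by rewrite logn_Ohm_Mho addnA [(_ + c k)%N]addnC -count_Ohm logn_Ohm_Mho.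
Qed.

Lemma logn_Ohm_count : logn p #|'Ohm_d(L)| = (\sum_(k < d) c k)%N.
Proof.
elim: (d) => [|k IHk]; first by rewrite Ohm0 cards1 logn1 big_ord0.
by rewrite big_ord_recr count_Ohm IHk addnC.
Qed.

Let c_le k : c k <= N.
Proof. exact: leq_trans (count_size _ _) sizeb. Qed.

(** The order of ['Ohm_d(L)] has as logarithm a sum of [d] counts, each at most [N], while its
    subgroup [U] already has logarithm [d * N]. *)
Lemma homocyclic_eq_Ohm : U = 'Ohm_d(L) :> {set gT}.
Proof.
have sU : U \subset 'Ohm_d(L).
  by apply/subsetP=> u Uu; apply/OhmP; rewrite (subsetP sUL) // expU.
apply/eqP; rewrite eqEcard sU cardU card_OhmE leq_exp2l ?prime_gt1 //.
rewrite logn_Ohm_count -[d in (d * N)%N]card_ord -sum_nat_const.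
by apply: leq_sum => i _; apply: c_le.
Qed.

(** A smaller count would make ['Ohm_d(L)] smaller than [U]. *)
Lemma homocyclic_count k : k < d -> c k = N.
Proof.
move=> lt_kd; apply/eqP; rewrite eqn_leq c_le /= leqNgt; apply/negP=> lt_ck.
have : \sum_(k < d) c k < d * N.
  rewrite -[d in (d * N)%N]card_ord -sum_nat_const.
  rewrite (bigD1 (Ordinal lt_kd)) //= [ltnRHS](bigD1 (Ordinal lt_kd)) //=.
  by rewrite -addSn leq_add // leq_sum.
by rewrite -logn_Ohm_count -homocyclic_eq_Ohm cardU pfactorK // ltnn.
Qed.
End Basis.

(** As [U] is ['Ohm_d(L)], dividing by it lowers the exponent of every cyclic factor by [d]. The
    last clause records this through the orders of ['Mho^k(L / U)], which determine the type of
    [L / U]. *)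
Lemma homocyclic_structure : exists xs : seq gT,
  [/\ \big[dprod/1]_(x <- xs) <[x]> = L, size xs = N,
      {in xs, forall x, d <= logn p #[x]}
    & forall k, (logn p #|'Mho^k(L / U)| =
        count [pred x | logn p #[x] > d + k] xs + logn p #|'Mho^k.+1(L / U)|)%N].
Proof.
have [b Db ob] := abelian_structure abL.
have sizeb : size b <= N.
  rewrite -(size_map order) ob size_abelian_type // (rank_pgroup pL) p_rank_abelian //.
  by rewrite -(leq_exp2l _ _ (prime_gt1 p_pr)) -card_OhmE.
have DU := homocyclic_eq_Ohm Db sizeb.
have nUL : L \subset 'N(U) := sub_abelian_norm abL sUL.
(* ['Ohm_(d + k)(L)] is the preimage of ['Ohm_k(L / U)]; the claim follows since orders of Ohm and
   Mho multiply to the order of the group. *)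
have cardM k : logn p #|'Mho^k(L / U)| = logn p #|'Mho^(d + k)(L)|.
  have DO : 'Ohm_(d + k)(L) / U = 'Ohm_k(L / U).
    have pQ : p.-group (L / U) by apply: quotient_pgroup.
    have abQ : abelian (L / U) by apply: quotient_abelian.
    apply/setP=> y; rewrite (OhmEabelian pQ) ?(abelianS (Ohm_sub _ _)) // !inE.
    apply/morphimP/andP=> [[x Nx /OhmP[Lx x1] ->] | [/morphimP[x Nx Lx ->] /eqP x1]].
      split; first exact: mem_quotient.
      have Uxk : x ^+ (p ^ k) \in U.
        by rewrite DU; apply/OhmP; rewrite groupX // -expgM -expnD addnC.
      by rewrite -morphX //= coset_id.
    exists x => //; apply/OhmP; split=> //.
    have : x ^+ (p ^ k) \in U by apply: coset_idr; rewrite ?groupX // morphX.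
    by rewrite DU => /OhmP[_]; rewrite -expgM -expnD addnC.
  have sUO : U \subset 'Ohm_(d + k)(L) by rewrite DU Ohm_leq // leq_addr.
  have := mul_card_Ohm_Mho_abelian k (quotient_abelian U abL).
  rewrite -DO !card_quotient //; last by rewrite (subset_trans (Ohm_sub _ _)).
  move=> E; congr (logn p _).
  have := mul_card_Ohm_Mho_abelian (d + k) abL.
  rewrite -(Lagrange sUO) -(Lagrange sUL) -E -!mulnA => /eqP.
  by rewrite !eqn_pmul2l ?cardG_gt0 // => /eqP.
(* The padding is nontrivial only if d = 0: a basis has no trivial elements. *)
exists (b ++ nseq (N - size b) 1); split.
- rewrite big_cat /= Db; elim: (_ - _) => [|k IHk]; first by rewrite big_nil dprodg1.
  by rewrite /= big_cons cycle1 dprod1g.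
- by rewrite size_cat size_nseq subnKC.
- move=> x; rewrite mem_cat; have [d0 | d_gt0] := posnP d; first by rewrite d0.
  have Nb : count [pred x | logn p #[x] > d.-1] b = N.
    by apply: homocyclic_count; rewrite ?prednK.
  have /eqP E : N == size b by rewrite eqn_leq sizeb -{1}Nb count_size.
  rewrite -{1}E subnn orbF => bx.
  have : all [pred x | logn p #[x] > d.-1] b by rewrite all_count Nb E.
  by move/allP/(_ x bx); rewrite /= prednK.
move=> k; rewrite !cardM addnS count_cat (count_Mho Db) count_nseq.
by rewrite /= order1 logn1 addn0.
Qed.
End HomocyclicSubgroup.

Lemma count_logn_abelian_type (gT : finGroupType) (p k : nat) (B : {group gT}) :
  abelian B ->
  logn p #|'Mho^k(B)| =
    (count (fun m => logn p m > k) (abelian_type B) + logn p #|'Mho^k.+1(B)|)%N.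
Proof.
by move=> abB; have [b Db <-] := abelian_structure abB; rewrite (count_Mho p abB Db) count_map.
Qed.

(** * Splitting off a subgroup that is pure modulo U *)

Section SplitSubgroup.
Variables (gT : finGroupType) (p : nat) (V B U : {group gT}).
Hypotheses (p_pr : prime p) (abV : abelian V) (pV : p.-group V).
Hypotheses (sBV : B \subset V) (sUV : U \subset V) (tiBU : B :&: U = 1).
Hypothesis pureBU : forall k v, v \in V -> v ^+ (p ^ k) \in B * U ->
  exists2 b, b \in B & b^-1 ^+ (p ^ k) * v ^+ (p ^ k) \in U.

Let nUV : V \subset 'N(U). Proof. exact: sub_abelian_norm. Qed.
Let nUB : B \subset 'N(U). Proof. exact: subset_trans sBV nUV. Qed.

(** [pure_complement] is applied to [B / U] in [V / U] and its result pulled back to [V]. The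
    pullback meets [B] inside [U], hence trivially. *)
Lemma pure_mod_complement : exists L : {group gT}, B \x L = V /\ U \subset L.
Proof.
have pureQ k (x : coset_of U) : x \in V / U -> x ^+ (p ^ k) \in B / U ->
    exists2 y, y \in B / U & x ^+ (p ^ k) = y ^+ (p ^ k).
  case/morphimP=> v Nv Vv ->; rewrite -morphX //= => Bvk.
  have : v ^+ (p ^ k) \in B * U.
    by rewrite (normC nUB) -quotientK // mem_morphpre ?groupX.
  case/pureBU=> // b Bb Ub; have Nb := subsetP nUB b Bb.
  exists (coset U b); first exact: mem_quotient.
  have := coset_id Ub; rewrite morphM ?groupX ?groupV // !morphX ?groupV // morphV //=.
  by rewrite expgVn => /eqP; rewrite -eq_mulVg1 => /eqP.
have [Q DQ] := pure_complement (quotient_abelian U abV) (quotient_pgroup U pV)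
  (quotientS U sBV) pureQ.
have [_ _ _ tiQ] := dprodP DQ.
have sQV : Q \subset V / U by have /dprodW/mulG_sub[] := DQ.
have nsUV : U <| V by rewrite /normal sUV.
have [L DL sUL sLV] := inv_quotientS nsUV sQV.
exists L; split=> //.
have tiBL : B :&: L = 1.
  apply/trivgP/subsetP=> b /setIP[Bb Lb]; rewrite -tiBU inE Bb /=.
  apply: coset_idr; first exact: (subsetP nUB).
  apply/set1gP; rewrite -tiQ inE DL !mem_quotient //.
rewrite dprodE ?(sub_abelian_cent2 abV) //; apply/eqP.
rewrite eqEsubset mul_subG //=; apply/subsetP=> v Vv.
have : coset U v \in (B / U) * Q by rewrite (dprodW DQ) mem_quotient.
rewrite DL => /mulsgP[_ _ /morphimP[b Nb Bb ->] /morphimP[x Nx Lx ->]].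
rewrite -morphM //= => /rcoset_kercosetP; rewrite (subsetP nUV) // groupM // => /(_ isT isT).
case/rcosetP=> u Uu ->; rewrite (centsP abV u) ?groupM ?(subsetP sUV u) ?(subsetP sBV b) ?(subsetP sLV x) //.
by rewrite -mulgA mem_mulg // groupM // (subsetP sUL).
Qed.

(** [T] is the full preimage of ['Mho^k(V / U)]. For unit groups it has a second count, by
    coefficients, and comparing the two gives the type of [V / U]. *)
Lemma card_Mho_quotient k (T : {set gT}) :
    (forall t, t \in T <-> t \in V /\ exists2 v, v \in V & (v ^+ (p ^ k))^-1 * t \in U) ->
  #|T| = (#|U| * #|'Mho^k(V / U)|)%N.
Proof.
move=> TP; have sMV := Mho_sub k V.
have DT : T = U * 'Mho^k(V).
  apply/setP=> t; apply/idP/idP.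
    case/TP=> Vt [v Vv Uvt]; apply/mulsgP.
    exists ((v ^+ (p ^ k))^-1 * t) (v ^+ (p ^ k)) => //.
      by rewrite (MhoEabelian k pV abV); apply/imsetP; exists v.
    by rewrite (centsP abV _ _ (v ^+ _)) ?mulKVg // ?groupM ?groupV ?groupX.
  rewrite (MhoEabelian k pV abV) => /mulsgP[u _ Uu /imsetP[v Vv ->] ->]; apply/TP.
  have Vu := subsetP sUV u Uu; split; first by rewrite groupM ?groupX.
  by exists v => //; rewrite (centsP abV u) ?groupX // mulKg.
have nUM : 'Mho^k(V) \subset 'N(U) := subset_trans sMV nUV.
rewrite DT -norm_joinEr // -(Lagrange (joing_subl U 'Mho^k(V))).
rewrite -card_quotient ?join_subG ?normG // quotientYidl //.
by congr (_ * #|pred_of_set _|)%N; apply: morphim_Mho.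
Qed.

(** [B] embeds in [V / U] because it meets [U] trivially, so [V / U] is the product of a copy of [B]
    and [L / U]. *)
Lemma split_Mho_quotient k (L : {group gT}) : B \x L = V -> U \subset L ->
  (#|'Mho^k(V / U)| = #|'Mho^k(B)| * #|'Mho^k(L / U)|)%N.
Proof.
move=> DV sUL; have nUL : L \subset 'N(U).
  by apply: subset_trans nUV; have /dprodW/mulG_sub[] := DV.
have DQ : (B / U) \x (L / U) = V / U.
  have abQ := quotient_abelian U abV; have [_ DBL _ tiBL] := dprodP DV.
  have DBLQ : (B / U) * (L / U) = V / U by rewrite -quotientMl // DBL.
  rewrite dprodE //; last by rewrite -quotientIG // tiBL quotient1.
  by apply: (sub_abelian_cent2 abQ); rewrite -DBLQ ?mulG_subl ?mulG_subr.
rewrite -(dprod_card (Mho_dprod k DQ)); congr (_ * _)%N.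
by apply: card_isog; apply: isog_Mho; rewrite isog_sym; apply: quotient_isog; rewrite // setIC.
Qed.
End SplitSubgroup.

Local Close Scope group_scope.
Local Open Scope ring_scope.

(** * The integral group ring *)

Section RegularRepresentation.
Variables (gT : finGroupType) (G : {group gT}).
Local Notation I := 'I_(#|G|.-1.+1).

Definition gidx (g : gT) : I := inord (index g (enum G)).

Lemma ltn_gidx (i : I) : (i < #|G|)%N.
Proof. by rewrite -{2}(prednK (cardG_gt0 G)). Qed.

Lemma gelt_in (i : I) : gelt G i \in G.
Proof. by rewrite -mem_enum mem_nth // -cardE ltn_gidx. Qed.

Lemma gidxK (g : gT) : g \in G -> gelt G (gidx g) = g.
Proof.
move=> Gg; rewrite /gelt /gidx inordK ?nth_index ?mem_enum //.
by rewrite (prednK (cardG_gt0 G)) cardE index_mem mem_enum.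
Qed.

Lemma geltK (i : I) : gidx (gelt G i) = i.
Proof.
apply: val_inj; rewrite /gidx /gelt /= index_uniq ?enum_uniq -?cardE ?ltn_gidx //.
by rewrite inordK.
Qed.

Section Coefficients.
Variable R : comUnitRingType.
Implicit Types (a b : {ffun gT -> R}) (M : 'M[R]_(#|G|.-1.+1)).

(** In the right-regular matrix of an element, the row of the identity lists its coefficients. *)
Definition mxcoef M (g : gT) : R := M (gidx 1%g) (gidx g).

Lemma mxcoef_regmx g h : g \in G -> h \in G ->
  mxcoef (regmx G R h) g = (g == h)%:R.
Proof. by move=> Gg Gh; rewrite /mxcoef mxE !gidxK // mul1g. Qed.

Lemma mxcoef_grelt a g : g \in G -> mxcoef (grelt G a) g = a g.
Proof.
move=> Gg; rewrite /mxcoef /grelt summxE (bigD1 g) //= big1 => [|h /andP[Gh neq]].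
  by rewrite addr0 mxE -/(mxcoef _ _) mxcoef_regmx // eqxx mulr1.
by rewrite mxE -/(mxcoef _ _) mxcoef_regmx // eq_sym (negPf neq) mulr0.
Qed.

Lemma eq_grelt a b : {in G, a =1 b} -> grelt G a = grelt G b.
Proof. by move=> eqab; apply: eq_bigr => g Gg; rewrite eqab. Qed.

Lemma regmxM g h : g \in G -> h \in G ->
  regmx G R g *m regmx G R h = regmx G R (g * h)%g.
Proof.
move=> Gg Gh; apply/matrixP=> i j; rewrite !mxE.
have Gig : (gelt G i * g)%g \in G by rewrite groupM ?gelt_in.
rewrite (bigD1 (gidx (gelt G i * g)%g)) //= big1 => [|k neq].
  by rewrite !mxE gidxK // eqxx mul1r addr0 mulgA.
rewrite !mxE; case: eqP => [def|_]; last by rewrite mul0r.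
by rewrite -def geltK eqxx in neq.
Qed.

Lemma regmx1 : regmx G R 1%g = 1%:M.
Proof.
apply/matrixP=> i j; rewrite !mxE mulg1; congr (_%:R); congr nat_of_bool.
by apply/eqP/eqP=> [def | -> //]; rewrite -(geltK i) -(geltK j) def.
Qed.

(** Membership is tested by rebuilding the matrix from its identity row, which makes it a boolean
    predicate. *)
Definition in_gring : {pred 'M[R]_(#|G|.-1.+1)} :=
  fun M => M == grelt G [ffun g => mxcoef M g].

Lemma in_gringP M : reflect (exists a, M = grelt G a) (M \in in_gring).
Proof.
apply: (iffP eqP) => [-> | [a ->]]; first by exists [ffun g => mxcoef M g].
by apply: eq_grelt => g Gg; rewrite ffunE mxcoef_grelt.
Qed.

Lemma grelt_in a : grelt G a \in in_gring.
Proof. by apply/in_gringP; exists a. Qed.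

Lemma regmx_in g : g \in G -> regmx G R g \in in_gring.
Proof.
move=> Gg; apply/in_gringP; exists [ffun h => (h == g)%:R].
rewrite /grelt (bigD1 g) //= big1 ?ffunE ?eqxx ?scale1r ?addr0 // => h /andP[_].
by rewrite ffunE => /negPf->; rewrite scale0r.
Qed.

Lemma in_gringZD (c : R) M M' :
  M \in in_gring -> M' \in in_gring -> c *: M + M' \in in_gring.
Proof.
case/in_gringP=> a ->; case/in_gringP=> b ->; apply/in_gringP.
exists [ffun g => c * a g + b g]; rewrite /grelt scaler_sumr -big_split /=.
by apply: eq_bigr => g _; rewrite ffunE scalerDl scalerA.
Qed.

Lemma in_gring0 : 0 \in in_gring.
Proof.
apply/in_gringP; exists [ffun=> 0].
by rewrite /grelt big1 // => g _; rewrite ffunE scale0r.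
Qed.

Lemma in_gring_sum J r (P : pred J) (F : J -> 'M[R]_(#|G|.-1.+1)) :
  (forall j, P j -> F j \in in_gring) -> \sum_(j <- r | P j) F j \in in_gring.
Proof.
move=> PF; elim/big_ind: _ => [|M M'|//]; first exact: in_gring0.
by move=> /(in_gringZD 1) h /h; rewrite scale1r.
Qed.

Lemma in_gringZ c M : M \in in_gring -> c *: M \in in_gring.
Proof. by move=> gM; rewrite -[c *: M]addr0 in_gringZD ?in_gring0. Qed.

Lemma in_gringM M M' :
  M \in in_gring -> M' \in in_gring -> M *m M' \in in_gring.
Proof.
case/in_gringP=> a ->; case/in_gringP=> b ->.
rewrite /grelt mulmx_suml; apply: in_gring_sum => g Gg.
rewrite mulmx_sumr; apply: in_gring_sum => h Gh.
by rewrite -scalemxAl -scalemxAr regmxM // !in_gringZ ?regmx_in ?groupM.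
Qed.

Lemma in_gringC M M' : abelian G ->
  M \in in_gring -> M' \in in_gring -> M *m M' = M' *m M.
Proof.
move=> abG; case/in_gringP=> a ->; case/in_gringP=> b ->.
rewrite /grelt mulmx_suml.
under eq_bigr do rewrite mulmx_sumr.
rewrite exchange_big mulmx_suml /=; apply: eq_bigr => g Gg.
rewrite mulmx_sumr; apply: eq_bigr => h Gh.
rewrite -!scalemxAl -!scalemxAr !regmxM // (centsP abG _ Gg _ Gh).
by rewrite !scalerA mulrC.
Qed.

Fact in_gring_subring : subring_closed in_gring.
Proof.
split=> [|M M' gM gM' | M M']; last exact: in_gringM.
  by rewrite -[1]regmx1 regmx_in.
by rewrite addrC -scaleN1r in_gringZD.
Qed.

Definition mxaug M := \sum_(g in G) mxcoef M g.

Lemma mxaug_grelt a : mxaug (grelt G a) = \sum_(g in G) a g.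
Proof. by apply: eq_bigr => g Gg; rewrite mxcoef_grelt. Qed.

End Coefficients.
End RegularRepresentation.

HB.instance Definition _ (gT : finGroupType) (G : {group gT}) (R : comUnitRingType) :=
  GRing.isSubringClosed.Build _ (in_gring (G := G) (R := R)) (@in_gring_subring gT G R).

(** * Ring structure, augmentation and coset sums *)

Section IntegralGroupRing.
Variables (gT : finGroupType) (G : {group gT}).

(* The commutativity proof is a phantom parameter: it lets the type carry a
   canonical commutative ring structure. *)
Record gring (abG : abelian G) := Gring {
  gring_mx : 'M[int]_(#|G|.-1.+1);
  gring_mxP : gring_mx \in in_gring (G := G) (R := int) }.

Variable abG : abelian G.
Local Notation A := (gring abG).

HB.instance Definition _ := [isSub for @gring_mx abG].
HB.instance Definition _ := [Choice of A by <:].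
HB.instance Definition _ := [SubChoice_isSubNzRing of A by <:].

Fact gring_mulC : commutative (@GRing.mul A).
Proof. by move=> x y; apply: val_inj; apply: in_gringC; rewrite ?gring_mxP. Qed.

HB.instance Definition _ := GRing.PzRing_hasCommutativeMul.Build A gring_mulC.

Implicit Types (x y : A) (g h : gT).

Definition gof (g : gT) : A := insubd 1 (regmx G int g).

Lemma val_gof g : g \in G -> val (gof g) = regmx G int g.
Proof. by move=> Gg; rewrite insubdK ?regmx_in. Qed.

Lemma gofM g h : g \in G -> h \in G -> gof (g * h)%g = gof g * gof h.
Proof.
by move=> Gg Gh; apply: val_inj; rewrite [RHS]/= !val_gof ?groupM // -regmxM.
Qed.

Lemma gof1 : gof 1%g = 1.
Proof. by apply: val_inj; rewrite val_gof // regmx1. Qed.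

Lemma gofX g k : g \in G -> gof (g ^+ k)%g = gof g ^+ k.
Proof.
move=> Gg; elim: k => [|k IHk]; first by rewrite gof1.
by rewrite expgS exprS gofM ?groupX // IHk.
Qed.

Lemma gofVM g : g \in G -> gof g^-1%g * gof g = 1.
Proof. by move=> Gg; rewrite -gofM ?groupV // mulVg gof1. Qed.

Definition gcoef g x : int := mxcoef (val x) g.

Lemma gcoef_is_zmod g : zmod_morphism (gcoef g).
Proof. by move=> x y; rewrite /gcoef /mxcoef raddfB !mxE. Qed.

HB.instance Definition _ g :=
  GRing.isZmodMorphism.Build A int (gcoef g) (gcoef_is_zmod g).

Lemma gcoef_sum J (r : seq J) (P : pred J) (F : J -> A) g :
  gcoef g (\sum_(j <- r | P j) F j) = \sum_(j <- r | P j) gcoef g (F j).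
Proof. exact: (raddf_sum (gcoef g)). Qed.

Lemma gcoefD x y g : gcoef g (x + y) = gcoef g x + gcoef g y.
Proof. exact: (raddfD (gcoef g)). Qed.

Lemma gcoefB x y g : gcoef g (x - y) = gcoef g x - gcoef g y.
Proof. exact: (raddfB (gcoef g)). Qed.

Lemma gcoefMz x (k : int) g : gcoef g (x *~ k) = gcoef g x * k.
Proof. by rewrite (raddfMz (gcoef g)) mulrzz. Qed.

Lemma gcoef_gof g h : g \in G -> h \in G -> gcoef g (gof h) = (g == h)%:R.
Proof. by move=> Gg Gh; rewrite /gcoef val_gof // mxcoef_regmx. Qed.

Lemma gcoef_sumz (a : gT -> int) g : g \in G ->
  gcoef g (\sum_(h in G) gof h *~ a h) = a g.
Proof.
move=> Gg; rewrite gcoef_sum (bigD1 g) //= big1 => [|h /andP[Gh neq]].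
  by rewrite addr0 gcoefMz gcoef_gof // eqxx mul1r.
by rewrite gcoefMz gcoef_gof // eq_sym (negPf neq) mul0r.
Qed.

Lemma val_sumz (a : gT -> int) :
  val (\sum_(h in G) gof h *~ a h) = grelt G [ffun h => a h].
Proof.
rewrite raddf_sum; apply: eq_bigr => h Gh.
by rewrite (raddfMz val) ffunE -scaler_int intz; congr (_ *: _); apply: val_gof.
Qed.

Lemma gringE x : x = \sum_(g in G) gof g *~ gcoef g x.
Proof.
apply: val_inj; rewrite val_sumz.
exact: (eqP (gring_mxP x)).
Qed.

Lemma gringP x y : {in G, gcoef^~ x =1 gcoef^~ y} -> x = y.
Proof.
by move=> eqxy; rewrite (gringE x) (gringE y); apply: eq_bigr => g /eqxy->.
Qed.

Lemma gcoefMg h x g : g \in G -> h \in G ->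
  gcoef g (gof h * x) = gcoef (h^-1 * g)%g x.
Proof.
move=> Gg Gh; rewrite {1}(gringE x) mulr_sumr gcoef_sum.
rewrite (bigD1 (h^-1 * g)%g) ?groupM ?groupV //= big1 => [|k /andP[Gk neq]].
  by rewrite addr0 mulrzAr gcoefMz -gofM ?groupM ?groupV // mulKVg gcoef_gof ?eqxx ?mul1r.
rewrite mulrzAr -gofM // gcoefMz gcoef_gof ?groupM //.
by case: (g =P _) neq => [-> | _ _]; rewrite ?mulKg ?eqxx // mul0r.
Qed.

Definition aug x : int := \sum_(g in G) gcoef g x.

Definition gsum (H : {set gT}) : A := \sum_(h in H) gof h.

Lemma gsumE (H : {set gT}) : gsum H = \sum_(h in H) gof h.
Proof. by []. Qed.

Lemma gcoef_gsumM (H : {group gT}) x g : H \subset G -> g \in G ->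
  gcoef g (gsum H * x) = \sum_(h in H) gcoef (h * g)%g x.
Proof.
move=> sHG Gg; rewrite mulr_suml gcoef_sum (reindex_inj invg_inj) /=.
apply: eq_big => [h | h Hh]; first by rewrite groupV.
by rewrite gcoefMg // ?invgK ?(subsetP sHG).
Qed.

Lemma gcoef_gsum (H : {group gT}) g : H \subset G -> g \in G ->
  gcoef g (gsum H) = (g \in H)%:R.
Proof.
move=> sHG Gg; rewrite gcoef_sum; case: (boolP (g \in H)) => [Hg | nHg].
  rewrite (bigD1 g) //= big1 ?addr0 => [|h /andP[Hh neq]]; first by rewrite gcoef_gof ?eqxx.
  by rewrite gcoef_gof // ?(subsetP sHG) // eq_sym (negPf neq).
apply: big1 => h Hh; rewrite gcoef_gof // ?(subsetP sHG) //.
by case: eqP nHg => // ->; rewrite Hh.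
Qed.

Lemma gsumM_gof (H : {group gT}) h : H \subset G -> h \in H ->
  gsum H * gof h = gsum H.
Proof.
move=> sHG Hh; rewrite mulr_suml [RHS](reindex_inj (mulIg h)) /=.
apply: eq_big => [k | k Hk]; first by rewrite groupMr.
by rewrite gofM ?(subsetP sHG).
Qed.

(** Group elements are absorbed by [gsum G], so multiplication by it sees only the augmentation.
    Multiplicativity of [aug] is read off from this. *)
Lemma gsumG_aug x : gsum G * x = gsum G *~ aug x.
Proof.
rewrite {1}(gringE x) mulr_sumr mulrz_sumr; apply: eq_bigr => g Gg.
by rewrite mulrzAr gsumM_gof.
Qed.

Lemma aug_is_zmod : zmod_morphism aug.
Proof.
by move=> x y; rewrite /aug -sumrB; apply: eq_bigr => g _; rewrite gcoefB.
Qed.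

HB.instance Definition _ := GRing.isZmodMorphism.Build A int aug aug_is_zmod.

Lemma aug_gof g : g \in G -> aug (gof g) = 1.
Proof.
move=> Gg; rewrite /aug (bigD1 g) //= big1 => [|h /andP[Gh /negPf neq]].
  by rewrite gcoef_gof ?eqxx.
by rewrite gcoef_gof ?neq.
Qed.

Lemma aug_is_monoid : monoid_morphism aug.
Proof.
split=> [|x y]; first by rewrite -gof1 aug_gof.
have: gcoef 1%g (gsum G *~ aug (x * y)) = gcoef 1%g (gsum G *~ (aug x * aug y)).
  by rewrite -gsumG_aug mulrA gsumG_aug mulrzAl gsumG_aug -mulrzA [aug y * _]mulrC.
by rewrite !gcoefMz gcoef_gsum ?group1 // !mul1r.
Qed.

HB.instance Definition _ := GRing.isMonoidMorphism.Build A int aug aug_is_monoid.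

Lemma gcoef_natM (m : nat) x g : gcoef g (m%:R * x) = m%:R * gcoef g x.
Proof. by rewrite mulr_natl (raddfMn (gcoef g)) mulr_natl. Qed.

(** The integral group ring is torsion free. Cancelling powers of p in this way is what the lift
    from Z/q to the integers makes possible. *)
Lemma gring_mulIn (m : nat) x y : (0 < m)%N -> m%:R * x = m%:R * y -> x = y.
Proof.
move=> m_gt0 eq_mx; apply: gringP => g _.
have:= congr1 (gcoef g) eq_mx; rewrite !gcoef_natM; apply: mulfI.
by rewrite natz eqz_nat -lt0n.
Qed.

Lemma gring_dvdP (m : nat) x :
  (exists y, x = m%:R * y) <-> {in G, forall g, (m %| gcoef g x)%Z}.
Proof.
split=> [[y ->] g _ | dv].
  by rewrite gcoef_natM dvdz_mulr // natz dvdzz.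
exists (\sum_(g in G) gof g *~ (gcoef g x %/ m)%Z).
apply: gringP => g Gg.
by rewrite gcoef_natM gcoef_sumz // mulrC natz divzK ?dv.
Qed.
End IntegralGroupRing.

(** * Congruences modulo powers of p *)

Section PrimePowers.
Variables (A : comNzRingType) (p : nat).
Hypothesis p_pr : prime p.
Implicit Types x y z : A.

(** The inner binomial coefficients are divisible by p. The linear term is kept apart so that the
    leading term in [x] stays visible after division by p. *)
Lemma expr1Dp x :
  exists r, (1 + x) ^+ p = 1 + p%:R * x * (1 + x * r) + x ^+ p.
Proof.
have p_gt1 := prime_gt1 p_pr.
exists (\sum_(2 <= i < p) x ^+ (i - 2) *+ ('C(p, i) %/ p)).
rewrite exprDn -(big_mkord xpredT (fun i => 1 ^+ (p - i) * x ^+ i *+ 'C(p, i))).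
rewrite big_nat_recr //= big_ltn 1?ltnW // big_ltn //.
rewrite !expr1n !mul1r bin0 bin1 binn !mulr1n expr0 expr1 !addrA; congr (_ + _).
rewrite -addrA; congr (_ + _); rewrite mulrDr mulr1 mulr_natl; congr (_ + _).
rewrite !mulr_sumr; apply: eq_big_nat => i /andP[i_gt1 lt_ip].
have /divnK {1}<- : (p %| 'C(p, i))%N by rewrite prime_dvd_bin // lt_ip ltnW.
rewrite mulrnA expr1n mul1r mulrnAl !mulrnAr; congr (_ *+ _ *+ _).
by rewrite -{1}(subnKC i_gt1) exprD expr2 mulrA.
Qed.

Lemma exprDp x y : exists z, (x + y) ^+ p = x ^+ p + y ^+ p + p%:R * z.
Proof.
have p_gt0 := prime_gt0 p_pr.
exists (\sum_(1 <= i < p) x ^+ (p - i) * y ^+ i *+ ('C(p, i) %/ p)).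
rewrite exprDn -(big_mkord xpredT (fun i => x ^+ (p - i) * y ^+ i *+ 'C(p, i))).
rewrite big_nat_recr //= big_ltn //.
rewrite bin0 binn subnn subn0 !expr0 mulr1 mul1r !mulr1n -!addrA; congr (_ + _).
rewrite addrC; congr (_ + _); rewrite mulr_sumr; apply: eq_big_nat => i lt0ip.
have /divnK {1}<- : (p %| 'C(p, i))%N by rewrite prime_dvd_bin.
by rewrite mulrnA mulr_natl.
Qed.

Lemma exprD_lin x y k : exists r, (x + y) ^+ k = x ^+ k + y * (k%:R * x ^+ k.-1 + y * r).
Proof.
elim: k => [|k [r IHk]]; first by exists 0; rewrite !expr0; ring.
exists (k%:R * x ^+ k.-1 + x * r + y * r); rewrite exprS IHk /=.
case: k IHk => [|k] _; rewrite /= !exprS -!natr1 ?expr0; ring.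
Qed.

(** The linear term gains a factor p from the exponent; the higher ones carry p^(2k), which suffices
    because [k] is positive. *)
Lemma expr_congr x y z k : (0 < k)%N -> x = y + (p ^ k)%:R * z ->
  exists z', x ^+ p = y ^+ p + (p ^ k.+1)%:R * z'.
Proof.
case: k => // k _ ->; have [r ->] := exprD_lin y ((p ^ k.+1)%:R * z) p.
exists (z * (y ^+ p.-1 + (p ^ k)%:R * z * r)).
by rewrite !expnS !natrM; ring.
Qed.

Lemma expr_congr_iter x y z k : x = y + p%:R * z ->
  exists z', x ^+ (p ^ k) = y ^+ (p ^ k) + (p ^ k.+1)%:R * z'.
Proof.
move=> def_x; elim: k => [|k [z' IHk]]; first by exists z; rewrite expn0 !expr1.
by have [//|z'' def] := expr_congr _ IHk; exists z''; rewrite expnSr !exprM.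
Qed.
End PrimePowers.

(** * The Frobenius identity modulo p *)

Section Frobenius.
Variables (gT : finGroupType) (G : {group gT}) (abG : abelian G) (p : nat).
Hypothesis p_pr : prime p.
Local Notation A := (gring abG).
Local Notation gof := (gof abG).

(* The k-th Adams operation, g |-> g^k extended linearly. *)
Definition adams (k : nat) (x : A) : A := \sum_(g in G) gof (g ^+ k)%g *~ gcoef g x.

Fact adams_is_zmod k : zmod_morphism (adams k).
Proof.
move=> x y; rewrite /adams -sumrB; apply: eq_bigr => g _.
by rewrite gcoefB mulrzBr.
Qed.

HB.instance Definition _ k := GRing.isZmodMorphism.Build A A (adams k) (adams_is_zmod k).

Lemma adams_gof k g : g \in G -> adams k (gof g) = gof (g ^+ k)%g.
Proof.
move=> Gg; rewrite /adams (bigD1 g) //= big1 => [|h /andP[Gh neq]].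
  by rewrite gcoef_gof // eqxx addr0.
by rewrite gcoef_gof // (negPf neq) mulr0z.
Qed.

Lemma adams_sumz k (I : finType) (P : {pred I}) (r : I -> gT) (a : I -> int) :
    (forall i, i \in P -> r i \in G) ->
  adams k (\sum_(i in P) gof (r i) *~ a i) = \sum_(i in P) gof (r i ^+ k)%g *~ a i.
Proof.
move=> Gr; rewrite raddf_sum; apply: eq_bigr => i Pi.
by rewrite raddfMz /= adams_gof ?Gr.
Qed.

Lemma frobenius1 (x : A) : exists z, x ^+ p = adams p x + p%:R * z.
Proof.
pose P (y f : A) := exists z, y ^+ p = f + p%:R * z.
have PD y f y' f' : P y f -> P y' f' -> P (y + y') (f + f').
  case=> z Dz [z' Dz']; have [z'' Dz''] := exprDp p_pr y y'.
  by exists (z + z' + z''); rewrite Dz'' Dz Dz'; ring.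
have P0 : P 0 0 by exists 0; rewrite expr0n gtn_eqF ?prime_gt0 // mulr0 addr0.
(* For p = 2 the sign of [y ^+ p] does not flip, so the case of [- y] is extracted from the
   expansion of [(y - y) ^+ p], which is 0. *)
have PN y f : P y f -> P (- y) (- f).
  case=> z Dz; have [z' Dz'] := exprDp p_pr y (- y).
  exists (- z - z'); move: Dz'; rewrite subrr expr0n gtn_eqF ?prime_gt0 //= Dz => /esym D.
  by apply/eqP; rewrite -subr_eq0; apply/eqP; rewrite -[RHS]D; ring.
have PMn y f m : P y f -> P (y *+ m) (f *+ m).
  by move=> Pyf; elim: m => [|m IHm]; rewrite ?mulr0n ?mulrS; auto.
have PMz y f (m : int) : P y f -> P (y *~ m) (f *~ m).
  by case: m => m; rewrite ?NegzE ?mulrNz -?pmulrn; auto.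
have: P (\sum_(g in G) gof g *~ gcoef g x) (adams p x).
  apply: (big_rec2 P) => // g y f Gg Pyf; apply: PD => //; apply: PMz.
  by exists 0; rewrite gofX // mulr0 addr0.
by rewrite -gringE.
Qed.

Lemma frobenius k (x : A) : exists z, x ^+ (p ^ k) = adams (p ^ k) x + p%:R * z.
Proof.
elim: k => [|k [z IHk]].
  by exists 0; rewrite {1}(gringE x) expr1 mulr0 addr0; apply: eq_bigr.
have [z1 D1] := frobenius1 (adams (p ^ k) x).
have [z2 D2] := expr_congr (k := 1) isT IHk.
exists (z1 + p%:R * z2); rewrite expnSr exprM D2 D1 !expnS expn0 muln1 natrM.
have -> : adams (p ^ k * p) x = adams p (adams (p ^ k) x); last by ring.
transitivity (\sum_(g in G) gof ((g ^+ (p ^ k)) ^+ p)%g *~ gcoef g x).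
  by apply: eq_bigr => g _; rewrite expgM.
by apply/esym; apply: adams_sumz => g; apply: groupX.
Qed.

(** The Adams operation of index p^n sends every group element to 1, so modulo p only the
    augmentation remains. *)
Lemma frobenius_aug n (x : A) : {in G, forall g, g ^+ (p ^ n) = 1}%g ->
  exists z, x ^+ (p ^ n) = (aug x)%:~R + p%:R * z.
Proof.
move=> G1; have [z ->] := frobenius n x; exists z; congr (_ + _).
rewrite /aug mulrz_sumr; apply: eq_bigr => g Gg.
by rewrite (G1 g Gg) gof1.
Qed.
End Frobenius.

(** * Torsion units modulo p^2 *)

Section CosetSums.
Variables (gT : finGroupType) (G : {group gT}) (abG : abelian G) (p : nat).
Local Notation A := (gring abG).
Local Notation gof := (gof abG).
Local Notation gsum := (gsum abG).

(** The kernel of the projection to the group ring of G/K over F_p is generated by p and the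
    elements [gof k - 1]. Each g is written as [t g * r g] with [r g] a fixed coset representative
    and [t g] in [K]. *)
Lemma gsum_kernel (K : {group gT}) (x z : A) : K \subset G ->
  gsum K * x = p%:R * z ->
  exists (y : A) (b : gT -> A), x = p%:R * y + \sum_(k in K) (gof k - 1) * b k.
Proof.
move=> sKG Kx; pose r g := repr (g *: K)%g; pose t g := (g * (r g)^-1)%g.
have rP g : r g \in (g *: K)%g by apply: (mem_repr g); apply: lcoset_refl.
have rG g : g \in G -> r g \in G.
  by move=> Gg; case/lcosetP: (rP g) => k Kk ->; rewrite groupM // (subsetP sKG).
have tK g : g \in G -> t g \in K.
  move=> Gg; rewrite /t; case/lcosetP: (rP g) => k Kk ->.
  have Gk := subsetP sKG k Kk; rewrite invMg (centsP abG k^-1%g) ?groupV //.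
  by rewrite mulKVg groupV.
(* The coefficients of [y] are the sums of those of [x] over cosets of [K], that is, coefficients of
   [gsum K * x]; hence p divides them. *)
pose y := \sum_(g in G) gof (r g) *~ gcoef g x.
have [y' Dy] : exists y', y = p%:R * y'.
  apply/gring_dvdP => h Gh; rewrite gcoef_sum.
  have ->: \sum_(g in G) gcoef h (gof (r g) *~ gcoef g x)
         = \sum_(g in G | r g == h) gcoef g x.
    rewrite big_mkcondr; apply: eq_bigr => g Gg.
    rewrite gcoefMz gcoef_gof ?rG // eq_sym.
    by case: eqP; rewrite ?mul1r ?mul0r.
  case: (eqVneq (r h) h) => [rh | nrh]; last first.
    rewrite big1 ?dvdz0 // => g /andP[Gg /eqP rgh]; case/eqP: nrh.
    rewrite /r; suff ->: (h *: K = g *: K)%g by [].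
    by apply/lcoset_eqP; rewrite -rgh rP.
  suff ->: \sum_(g in G | r g == h) gcoef g x = gcoef h (gsum K * x).
    by rewrite Kx gcoef_natM natz dvdz_mulr.
  rewrite gcoef_gsumM // [RHS](reindex_inj (mulIg h^-1)%g) /=.
  apply: eq_big => [g | g _]; last by rewrite mulgKV.
  apply/andP/idP => [[Gg /eqP <-] | Kgh]; first exact: tK.
  have Gg : g \in G by rewrite -[g](mulgKV h) groupM ?(subsetP sKG _ Kgh).
  split=> //; apply/eqP; rewrite -[RHS]rh /r.
  suff ->: (g *: K = h *: K)%g by [].
  apply/lcoset_eqP; rewrite mem_lcoset.
  by rewrite (centsP abG h^-1%g) ?groupV.
exists y', (fun k => \sum_(g in G | t g == k) gof (r g) *~ gcoef g x).
rewrite -Dy {1}(gringE x).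
have ->: \sum_(k in K) (gof k - 1) * (\sum_(g in G | t g == k) gof (r g) *~ gcoef g x)
       = \sum_(g in G) (gof (t g) - 1) * (gof (r g) *~ gcoef g x).
  rewrite [RHS](partition_big t (mem K)) //=; apply: eq_bigr => k Kk.
  by rewrite mulr_sumr; apply: eq_bigr => g /andP[_ /eqP->].
rewrite -big_split /=; apply: eq_bigr => g Gg.
rewrite mulrzAr -mulrzDl mulrBl mul1r addrC subrK -(gofM abG (subsetP sKG _ (tK _ Gg)) (rG g Gg)).
by rewrite mulgKV.
Qed.
End CosetSums.

(** * Descent from K to a subgroup H of index p *)

Section HigmanStep.
Variables (gT : finGroupType) (G : {group gT}) (abG : abelian G) (p n : nat).
Hypotheses (p_pr : prime p) (expG : {in G, forall g, g ^+ (p ^ n) = 1}%g).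
Local Notation A := (gring abG).
Local Notation gof := (gof abG).
Local Notation gsum := (gsum abG).
Variables (H K : {group gT}) (c : gT).
Hypotheses (sHK : H \subset K) (sKG : K \subset G) (indexHK : #|K : H|%g = p).
Hypotheses (Kc : c \in K) (nHc : c \notin H).
Let s : A := gsum H.
Let y : A := gof c - 1.

Let sHG : H \subset G := subset_trans sHK sKG.
Let Gc : c \in G := subsetP sKG c Kc.

Let sgof h : h \in H -> s * gof h = s.
Proof. exact: gsumM_gof. Qed.

(* Multiplication by s realises the projection to Z[G/H]: [smod d x] says that x
   is 0 modulo d in Z[G/H]. *)
Definition smod (d : A) (x : A) := exists z, s * x = d * z.

Lemma smodD d x x' : smod d x -> smod d x' -> smod d (x + x').
Proof. by case=> z E [z' E']; exists (z + z'); rewrite mulrDr E E' mulrDr. Qed.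

Lemma smodM d x x' : smod d x -> smod d (x * x').
Proof. by case=> z E; exists (z * x'); rewrite mulrA E mulrA. Qed.

Lemma smodN d x : smod d x -> smod d (- x).
Proof. by case=> z E; exists (- z); rewrite mulrN E mulrN. Qed.

Lemma smod_mul d x : smod d (d * x).
Proof. by exists (s * x); ring. Qed.

Lemma smod_ann d x : s * x = 0 -> smod d x.
Proof. by move=> E; exists 0; rewrite E mulr0. Qed.

Local Notation J1 := (smod p%:R).
Local Notation J2 := (smod (p%:R ^+ 2)).

Lemma smod_split x : J1 x -> exists z b, x = p%:R * z + b /\ s * b = 0.
Proof.
case=> z /(gsum_kernel sHG)[y' [b ->]]; exists y'; eexists; split; first by [].
rewrite mulr_sumr big1 // => h Hh.
by rewrite mulrA mulrBr sgof // mulr1 subrr mul0r.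
Qed.

(** [K] is generated by [H] and [c], so in Z[G/H] the element is [gof c ^+ i - 1] for some [i], a
    multiple of [y]. *)
Lemma sgof_sub1 k : k \in K -> exists r, s * (gof k - 1) = s * (y * r).
Proof.
have nsHK : (H <| K)%g.
  rewrite /normal sHK /=; apply: subset_trans (cents_norm _); first exact: subxx.
  exact: centsS sHG (subset_trans sKG abG).
have maxH : maximal H K by apply: p_index_maximal; rewrite ?indexHK.
have <- : (H * <[c]> = K)%g.
  by apply: mulg_normal_maximal; rewrite ?cycle_subG.
case/mulsgP=> h _ Hh /cycleP[i ->] ->.
have Gh := subsetP sHG h Hh.
exists (\sum_(j < i) gof c ^+ j).
rewrite gofM ?groupX // [LHS]mulrBr [X in X - _]mulrA sgof // gofX //.
by rewrite -subrX1 mulrBr.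
Qed.

(** A transversal of [H] in [K] has p elements, each congruent to 1 modulo [y] in Z[G/H]. *)
Lemma sgsum : exists r, gsum K = s * (p%:R + y * r).
Proof.
have E k : k \in K -> exists r, s * (gof k - 1) = s * (y * r) by apply: sgof_sub1.
pose D (B : {set gT}) := gof (repr B) - 1.
have P : partition (rcosets H K) K by apply: rcosets_partition.
have -> : gsum K = s * \sum_(B in rcosets H K) gof (repr B).
  rewrite gsumE (set_partition_big _ P) mulr_sumr.
  apply: eq_bigr => B /rcosetsP[k Kk ->].
  case: repr_rcosetP => h Hh; set k' := (h * k)%g.
  have Gk' : k' \in G by rewrite groupM ?(subsetP sHG h) ?(subsetP sKG k).
  have -> : (H :* k = H :* k')%g by rewrite /k' rcosetM (rcoset_id Hh).
  rewrite /s gsumE mulr_suml [LHS](reindex_inj (mulIg k')) /=.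
  apply: eq_big => [a | a]; first by rewrite mem_rcoset mulgK.
  by rewrite mem_rcoset mulgK => Ha; rewrite gofM ?(subsetP sHG a).
have [r Dr] : exists r, s * \sum_(B in rcosets H K) D B = s * (y * r).
  rewrite mulr_sumr; apply: (big_ind (fun z => exists r, z = s * (y * r))).
  - by exists 0; rewrite !mulr0.
  - by move=> _ _ [a ->] [b ->]; exists (a + b); ring.
  move=> B /rcosetsP[k Kk ->]; apply: E; case: repr_rcosetP => h Hh.
  by rewrite groupM ?(subsetP sHK h).
exists r.
have -> : \sum_(B in rcosets H K) gof (repr B) = p%:R + \sum_(B in rcosets H K) D B.
  rewrite /D sumrB sumr_const; set S := \sum_(B in _) _.
  by rewrite -indexHK /indexg; ring.
by rewrite mulrDr Dr; ring.
Qed.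

Lemma smod_K_lift x z : gsum K * x = p%:R * z -> exists w, J1 (x - y * w).
Proof.
case/(gsum_kernel sKG)=> z' [b ->].
have [w Dw] : exists w, s * \sum_(k in K) (gof k - 1) * b k = s * (y * w).
  rewrite mulr_sumr; apply: (big_ind (fun z => exists r, z = s * (y * r))).
  - by exists 0; rewrite !mulr0.
  - by move=> _ _ [a ->] [b' ->]; exists (a + b'); ring.
  by move=> k /sgof_sub1[r' Dr']; exists (r' * b k); rewrite mulrA Dr'; ring.
by exists w; exists (s * z'); rewrite mulrBr mulrDr Dw; ring.
Qed.

(** By [sgsum], the sum over [K] is p plus a multiple of [y] in Z[G/H]. So an [x] killed by [y]
    modulo p vanishes modulo p in Z[G/K], and [smod_K_lift] applies. *)
Lemma smod_y_exact x : J1 (y * x) -> exists w, J1 (x - y * w).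
Proof.
case=> z Dz; have [r Dr] := sgsum.
apply: (@smod_K_lift _ (s * x + z * r)).
rewrite Dr; transitivity (p%:R * (s * x) + s * (y * x) * r); first by ring.
by rewrite Dz; ring.
Qed.

Lemma smod_pM x : J2 (p%:R * x) -> J1 x.
Proof.
case=> z Dz; exists z; apply: (gring_mulIn (prime_gt0 p_pr)).
by rewrite mulrCA Dz; ring.
Qed.

(* As y is nilpotent modulo (p, Ann s), the second factor is a unit there. *)
Lemma smod_lead w r : J1 (y ^+ p) -> J1 (y * w * (1 + y * w * r)) -> J1 (y * w).
Proof.
move=> Jyp; set t := y * w * r => Jt.
have E : 1 - (- t) ^+ p = (1 + t) * \sum_(i < p) (- t) ^+ i.
  by rewrite -opprB subrX1 -mulNr; congr (_ * _); ring.
have -> : y * w = y * w * (1 + t) * (\sum_(i < p) (- t) ^+ i) + y ^+ p * ((- (w * r)) ^+ p * y * w).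
  rewrite -mulrA -E; have -> : (- t) ^+ p = y ^+ p * (- (w * r)) ^+ p.
    by rewrite -exprMn; congr (_ ^+ _); rewrite /t; ring.
  ring.
by apply: smodD; apply: smodM.
Qed.

(** This is [expr_congr] in Z[G/H]: the part [b] of [v - u] annihilated by [s] contributes nothing
    after multiplication by [s]. *)
Lemma smod_expr v u : J1 (v - u) -> J2 (v ^+ p - u ^+ p).
Proof.
case/smod_split=> z [b [Dv sb]].
have [r Dr] := exprD_lin (u + p%:R * z) b p.
have [z' Dz'] := expr_congr (x := u + p%:R * z) (z := z) (k := 1) isT (erefl _).
exists (s * z'); have -> : v = u + p%:R * z + b by rewrite -addrA -Dv; ring.
rewrite Dr Dz' natrX.
transitivity (s * b * (p%:R * (u + p%:R * z) ^+ p.-1 + b * r) + p%:R ^+ 2 * (s * z')).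
  by ring.
by rewrite sb mul0r add0r.
Qed.

Lemma smod_21 x : J2 x -> J1 x.
Proof. by case=> z Dz; exists (p%:R * z); rewrite Dz; ring. Qed.

Let cp_H : (c ^+ p)%g \in H.
Proof.
have nsHK : (H <| K)%g.
  rewrite /normal sHK /=; apply: subset_trans (cents_norm _); first exact: subxx.
  exact: centsS sHG (subset_trans sKG abG).
have Nc : c \in 'N(H)%g by rewrite (subsetP (normal_norm nsHK)).
apply: coset_idr; rewrite ?groupX // morphX //.
apply/eqP; rewrite -order_dvdn -indexHK -card_quotient ?normal_norm //.
by rewrite order_dvdG // mem_quotient.
Qed.

(** Since c^p lies in [H], the p-th power of [1 + y] is 1 in Z[G/H]; solving its expansion for
    [y ^+ p] gives the formula. In particular [y] is nilpotent modulo p there. *)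
Lemma smod_yp : exists r, s * y ^+ p = - (p%:R * (s * (y * (1 + y * r)))).
Proof.
have [r Dr] := expr1Dp p_pr y; exists r.
have : s * (1 + y) ^+ p = s by rewrite addrC subrK -gofX // sgof.
rewrite Dr => E.
transitivity (s * (1 + p%:R * y * (1 + y * r) + y ^+ p) - s - p%:R * (s * (y * (1 + y * r)))).
  by ring.
by rewrite E subrr sub0r.
Qed.

Lemma smod_mem h : h \in G -> J1 (gof h - 1) -> h \in H.
Proof.
move=> Gh [z]; rewrite mulrBr mulr1 => /(congr1 (gcoef h)).
rewrite gcoef_natM gcoefB [s * _]mulrC gcoefMg // mulVg !gcoef_gsum // group1.
case: (h \in H) => // E.
have := dvdz_mulr (gcoef h z) (dvdzz p); rewrite -[p%:Z]natz -E /= subr0.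
by rewrite dvdz1 natz => /eqP p1; have := p_pr; rewrite -[p]absz_nat p1.
Qed.

Lemma higman_step g (v z1 : A) : g \in G -> v ^+ p = 1 + p%:R ^+ 2 * z1 ->
  (exists z, gsum K * (v - gof g) = p%:R * z) ->
  exists2 g', g' \in G & J1 (v - gof g').
Proof.
move=> Gg Dvp [z0 Dz0]; have [r0 Dyp] := smod_yp.
have Jyp : J1 (y ^+ p) by exists (- (s * (y * (1 + y * r0)))); rewrite Dyp; ring.
(* Two expressions for the p-th power of [gof h * v] modulo p^2 are compared; [y ^+ p] is replaced
   using [smod_yp], and one factor p is cancelled. *)
have keyE h (w : A) : h \in G -> J1 (gof h * v - (1 + y * w)) ->
    exists r, J1 (y * (w * (1 + y * w * r) - (1 + y * r0) * w ^+ p)).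
  move=> Gh Jw; have [r Dr] := expr1Dp p_pr (y * w); exists r.
  have J2u := smod_expr Jw; have Ehv : (gof h * v) ^+ p = gof (h ^+ p)%g * (1 + p%:R ^+ 2 * z1).
    by rewrite exprMn Dvp gofX.
  (* Modulo p both p-th powers reduce, to h^p and to 1, because [y ^+ p] vanishes. *)
  have Hhp : (h ^+ p)%g \in H.
    apply: smod_mem; rewrite ?groupX //.
    have -> : gof (h ^+ p)%g - 1 = ((gof h * v) ^+ p - (1 + y * w) ^+ p) + (p%:R * (y * w * (1 + y * w * r) - gof (h ^+ p)%g * (p%:R * z1)) + y ^+ p * w ^+ p).
      by rewrite Dr Ehv exprMn; ring.
    apply: smodD; first exact: smod_21.
    by apply: smodD; [apply: smod_mul | apply: smodM].
  apply: smod_pM; have [z Dz] := J2u; exists (s * z1 - z).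
  have <- : s * (1 + y * w) ^+ p - s = p%:R ^+ 2 * (s * z1 - z).
    have -> : p%:R ^+ 2 * (s * z1 - z) = p%:R ^+ 2 * (s * z1) - s * ((gof h * v) ^+ p - (1 + y * w) ^+ p) by rewrite Dz; ring.
    rewrite mulrBr Ehv [s * (gof _ * _)]mulrA sgof //; ring.
  rewrite Dr exprMn.
  transitivity (s * (p%:R * (y * w * (1 + y * w * r))) - p%:R * (s * (y * (1 + y * r0))) * w ^+ p).
    by ring.
  by rewrite -mulNr -Dyp; ring.
have [w Jw] : exists w, J1 (gof g^-1%g * v - 1 - y * w).
  apply: (@smod_K_lift _ (gof g^-1%g * z0)).
  have -> : gof g^-1%g * v - 1 = gof g^-1%g * (v - gof g) by rewrite mulrBr gofVM.
  by rewrite mulrCA Dz0; ring.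
have {}Jw : J1 (gof g^-1%g * v - (1 + y * w)) by rewrite opprD addrA.
have [r1 Jr1] := keyE _ _ (groupVr Gg) Jw.
have [w1 Jw1] := smod_y_exact Jr1.
(* [C] is the ideal generated by [y], p and the annihilator of [s]. *)
pose C (x : A) := exists t : A, J1 (x - y * t).
have CD x x' : C x -> C x' -> C (x + x').
  case=> t Ct [t' Ct']; exists (t + t').
  by rewrite mulrDr opprD addrACA; apply: smodD.
have CM (x x' : A) : C x -> C (x * x').
  by case=> t Ct; exists (t * x'); rewrite mulrA -mulrBl; apply: smodM.
have CJ x : J1 x -> C x by exists 0; rewrite mulr0 subr0.
(* The relation [Jr1] says that [y] kills a difference congruent to [w - w ^+ p] modulo [y]; by
   exactness that difference is itself a multiple of [y]. *)
have Cw : C (w - w ^+ p).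
  exists (w1 - w ^+ 2 * r1 + r0 * w ^+ p); congr smod: Jw1; ring.
(* Modulo (y, p, Ann s), w is fixed by the Frobenius map, hence constant. *)
have [w3 Jw3] : C (w - (aug w)%:~R).
  suff: C (w - w ^+ (p ^ n)).
    have [z ->] := frobenius_aug p_pr w expG => Cwn.
    have -> : w - (aug w)%:~R = w - ((aug w)%:~R + p%:R * z) + p%:R * z by ring.
    by apply: CD => //; apply: CJ; apply: smod_mul.
  elim: (n) => [|k IHk]; first by rewrite expr1 subrr; apply: CJ; exists 0; rewrite !mulr0.
  have -> : w - w ^+ (p ^ k.+1) = w - w ^+ (p ^ k) + (w ^+ (p ^ k) - (w ^+ p) ^+ (p ^ k)).
    by rewrite expnS exprM; ring.
  by apply: CD; [exact: IHk | rewrite subrXX; exact: CM].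
(* The constant is represented by a natural number [m], since c^m = (1 + y)^m begins with 1 + m y
   and so can absorb it. *)
have [m [t Dm]] : exists (m : nat) (t : int), aug w = m%:Z + p%:Z * t.
  exists `|(aug w %% p)%Z|%N, (aug w %/ p)%Z.
  rewrite gez0_abs ?modz_ge0 //; last by rewrite eqz_nat -lt0n prime_gt0.
  by rewrite addrC mulrC -divz_eq.
have [r2 Dr2] := exprD_lin 1 y m.
pose g' := (g * c ^+ m)%g; have Gg' : g' \in G by rewrite groupM ?groupX.
pose u := gof (c ^+ m)^-1%g; pose w4 := (w3 - r2) * u.
have Dg' : gof g'^-1%g = gof g^-1%g * u.
  by rewrite /g' invMg gofM ?groupV ?groupX // mulrC.
(* With the corrected representative [g'], the deviation from 1 is divisible by [y ^+ 2]. *)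
have Ju : J1 (gof g'^-1%g * v - (1 + y * (y * w4))).
  have E : u * (1 + m%:R * y + y ^+ 2 * r2) = 1.
    rewrite -[RHS](gofVM abG (groupX m Gc)) -/u; congr (u * _).
    rewrite gofX // -[gof c](subrK 1) -/y [y + 1]addrC Dr2 !expr1n; ring.
  have -> : gof g'^-1%g * v - (1 + y * (y * w4)) =
     (gof g^-1%g * v - (1 + y * w)) * u + (w - (aug w)%:~R - y * w3) * (y * u)
     + p%:R * (t%:~R * y * u).
    have -> : (aug w)%:~R = m%:R + p%:R * t%:~R :> A by rewrite Dm intrD intrM -!pmulrn.
    transitivity (gof g^-1%g * u * v - u * (1 + m%:R * y + y ^+ 2 * r2) - y * (y * w4)).
      by rewrite E Dg'; ring.
    by rewrite /w4; ring.
  by apply: smodD; [apply: smodD; apply: smodM | apply: smod_mul].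
(* In the second use of [keyE] the p-th power term contains [y ^+ p] and vanishes modulo p, so
   [smod_lead] removes the whole deviation. *)
have [r3 Jr3] := keyE _ _ (groupVr Gg') Ju.
have {}Jr3 : J1 (y * (y * w4)).
  apply: (@smod_lead _ r3) => //.
  have -> : y * (y * w4) * (1 + y * (y * w4) * r3) =
     y * (y * w4 * (1 + y * (y * w4) * r3) - (1 + y * r0) * (y * w4) ^+ p)
     + y ^+ p * (y * (1 + y * r0) * w4 ^+ p) by rewrite exprMn; ring.
  by apply: smodD => //; apply: smodM.
exists g' => //.
have -> : v - gof g' = (gof g'^-1%g * v - (1 + y * (y * w4)) + y * (y * w4)) * gof g'.
  have E := gofVM abG Gg'.
  transitivity ((gof g'^-1%g * gof g') * v - gof g'); last by ring.
  by rewrite E mul1r.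
by apply: smodM; apply: smodD.
Qed.
End HigmanStep.

(** * Torsion modulo higher powers of p *)

Section TorsionUnits.
Variables (gT : finGroupType) (G : {group gT}) (abG : abelian G) (p n : nat).
Hypotheses (p_pr : prime p) (expG : {in G, forall g, g ^+ (p ^ n) = 1}%g).
Local Notation A := (gring abG).
Local Notation gof := (gof abG).
Local Notation gsum := (gsum abG).

Let pG : (p.-group G)%g.
Proof.
rewrite -pnat_exponent; apply: (@pnat_dvd _ (p ^ n)); first exact/exponentP.
by rewrite pnatX pnat_id.
Qed.

Lemma torsion_mod_p2 (v z1 : A) : aug v = 1 -> v ^+ p = 1 + p%:R ^+ 2 * z1 ->
  exists2 g, g \in G & exists z, v = gof g + p%:R * z.
Proof.
move=> aug1 Dvp.
pose P (K : {group gT}) := exists2 g, g \in G &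
  exists z, gsum K * (v - gof g) = p%:R * z.
have descend (K : {group gT}) : K \subset G -> P K -> P 1%G.
  have [m] := ubnP #|K|; elim: m K => // m IHm K; rewrite ltnS => leKm sKG [g Gg PK].
  have [K1 | [H maxH _]] := maximal_exists (sub1G K).
    by have <- : K = 1%G by [apply: val_inj]; exists g.
  have pK := pgroupS sKG pG.
  have [sHK /subsetPn[c Kc nHc]] := andP (maxgroupp maxH).
  have [g' Gg' PH] : exists2 g', g' \in G & smod H p%:R (v - gof g').
    exact: (higman_step p_pr expG sHK sKG (p_maximal_index pK maxH) Kc nHc Gg Dvp PK).
  apply: (IHm H); last by exists g'.
    by rewrite (leq_trans _ leKm) // proper_card // properE sHK; apply/subsetPn; exists c.
  exact: subset_trans sHK sKG.
have [g Gg [z]] : P 1%G.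
  (* The descent starts at [G] itself, where only the augmentation is visible and [v] agrees with
     1. *)
  apply: (descend G) => //; exists 1%g => //; exists 0.
  by rewrite gof1 mulr0 mulrBr gsumG_aug aug1 mulr1 subrr.
rewrite gsumE big_set1 gof1 mul1r => Dv.
by exists g => //; exists z; rewrite -Dv addrC subrK.
Qed.

(** Iterating the relation makes [x] an integer multiple of its p^n-th power modulo p, and that
    power is congruent to [aug x], hence to 0. *)
Lemma pfixed_dvd (x z : A) (c : int) : (p %| aug x)%Z ->
  x = c%:~R * x ^+ p + p%:R * z -> exists z', x = p%:R * z'.
Proof.
move=> /dvdzP[a Da] Dx.
have [d [z' ->]] : exists (d : int) z', x = d%:~R * x ^+ (p ^ n) + p%:R * z'.
  elim: (n) => [|k [d [z' Dxk]]]; first by exists 1, 0; rewrite expr1; ring.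
  have [z2 Dz2] := expr_congr_iter k Dx.
  exists (d * c ^+ (p ^ k)), (z' + d%:~R * (p ^ k)%:R * z2).
  rewrite {1}Dxk Dz2 exprMn -exprM -expnS intrM !natrX rmorphXn /= [p%:R ^+ k.+1]exprS; ring.
have [z2 ->] := frobenius_aug p_pr x expG.
by exists (d%:~R * (a%:~R + z2) + z'); rewrite Da intrM -pmulrn; ring.
Qed.

(** Expanding and dividing by p^(k+1) leaves [x] congruent modulo p to an integer multiple of
    [x ^+ p], and [x] has augmentation 0. It moves a p-torsion unit from level [k] of the congruence
    filtration to the next. *)
Lemma torsion_congruence_unit k e (x z : A) : (0 < k)%N -> (k.+1 < e)%N ->
  aug (1 + (p ^ k)%:R * x) = 1 ->
  (1 + (p ^ k)%:R * x) ^+ p = 1 + (p ^ e)%:R * z -> exists z', x = p%:R * z'.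
Proof.
move=> k_gt0 lt_ke aug1 E.
have p_gt1 := prime_gt1 p_pr.
have aug0 : aug x = 0.
  apply/eqP; have /eqP := aug1.
  rewrite rmorphD rmorph1 rmorphM rmorph_nat -subr_eq0 addrC addKr mulf_eq0.
  by rewrite natz eqz_nat expn_eq0 gtn_eqF ?(ltnW p_gt1).
have [r Dr] := expr1Dp p_pr ((p ^ k)%:R * x).
(* The exponent [j] is 0 only for p = 2 and k = 1; then the term in [x ^+ p] survives modulo p, and
   [pfixed_dvd] is needed in earnest. *)
have [j Dj] : exists j, (k * p = k.+1 + j)%N.
  by exists (k * p - k.+1)%N; rewrite subnKC //; nia.
have [i Di] : exists i, (e = k.+2 + i)%N by exists (e - k.+2)%N; rewrite subnKC.
apply: (@pfixed_dvd x ((p ^ i)%:R * z - (p ^ k.-1)%:R * x ^+ 2 * r) (- (p ^ j)%:Z)).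
  by rewrite aug0 dvdz0.
have pk_gt0 : (0 < p ^ k.+1)%N by rewrite expn_gt0 ltnW.
apply: (gring_mulIn pk_gt0).
have Ek : (p ^ k = p * p ^ k.-1)%N by rewrite -expnS prednK.
move: E; rewrite Dr exprMn -natrX -expnM Dj Di !expnD !expnS !natrM.
rewrite rmorphN /= -pmulrn => /eqP; rewrite -subr_eq0 => /eqP E.
apply/eqP; rewrite -subr_eq0; apply/eqP; rewrite -[RHS]E Ek natrM; ring.
Qed.
End TorsionUnits.

(** * Normalized units of (Z/q)G *)

Lemma intr_Zp_eq0 (m : nat) (k : int) : (1 < m)%N ->
  (k%:~R == 0 :> 'Z_m) = (m %| k)%Z.
Proof.
move=> m_gt1; have nat_eq0 (i : nat) : (i%:R == 0 :> 'Z_m) = (m %| i)%N.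
  by rewrite -val_eqE /= val_Zp_nat.
case: k => k; first by rewrite -pmulrn nat_eq0 dvdzE.
by rewrite NegzE mulrNz -pmulrn oppr_eq0 nat_eq0 dvdzE abszN.
Qed.

Section NormalizedUnits.
Variables (gT : finGroupType) (G : {group gT}) (abG : abelian G) (m : nat).
Hypothesis m_gt1 : (1 < m)%N.
Local Notation A := (gring abG).
Local Notation gof := (gof abG).

Definition reduce_mod (x : A) : 'M['Z_m]_(#|G|.-1.+1) := map_mx intr (gring_mx x).

Lemma reduce_mod1 : reduce_mod 1 = 1.
Proof. by rewrite /reduce_mod rmorph1. Qed.

Lemma reduce_modM x y : reduce_mod (x * y) = reduce_mod x * reduce_mod y.
Proof. exact: (map_mxM intr (gring_mx x) (gring_mx y)). Qed.

Lemma reduce_mod_grelt x : reduce_mod x = grelt G [ffun g => (gcoef g x)%:~R].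
Proof.
have Dx : gring_mx x = grelt G [ffun g => gcoef g x] by apply: (eqP (gring_mxP x)).
rewrite /reduce_mod {1}Dx /grelt raddf_sum; apply: eq_bigr => g Gg.
apply/matrixP=> i j; rewrite !mxE !ffunE /= rmorphM /= rmorph_nat //.
Qed.

Lemma reduce_mod_gof g : g \in G -> reduce_mod (gof g) = regmx G 'Z_m g.
Proof.
move=> Gg; rewrite /reduce_mod; have -> : gring_mx (gof g) = regmx G int g by apply: val_gof.
by apply/matrixP=> i j; rewrite !mxE rmorph_nat.
Qed.

Lemma reduce_mod_eqP x y : reduce_mod x = reduce_mod y <-> exists z, x = y + m%:R * z.
Proof.
split=> [E | [z ->]].
  have /gring_dvdP[z Dz] : {in G, forall g, (m %| gcoef g (x - y)%R)%Z}.
    move=> g Gg; rewrite -intr_Zp_eq0 // gcoefB intrB subr_eq0.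
    have := congr1 (fun M => mxcoef M g) E; rewrite !reduce_mod_grelt !mxcoef_grelt // !ffunE.
    by move=> ->.
  by exists z; rewrite -Dz addrC subrK.
rewrite !reduce_mod_grelt; apply: eq_grelt => g Gg; rewrite !ffunE gcoefD intrD gcoef_natM.
rewrite natz; have /eqP -> : (m%:Z * gcoef g z)%:~R == 0 :> 'Z_m.
  by rewrite intr_Zp_eq0 // dvdz_mulr.
by rewrite addr0.
Qed.

(** The default 1 serves only to make the map total: for a prime power modulus, [val_unit_of] shows
    that augmentation 1 gives a unit. *)
Definition unit_of (x : A) : {'GL_#|G|['Z_m]} :=
  insubd (1%g : {'GL_#|G|['Z_m]}) (reduce_mod x).

Lemma grelt_lift (a : {ffun gT -> 'Z_m}) : \sum_(g in G) a g = 1 ->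
  exists2 x, aug x = 1 & reduce_mod x = grelt G a.
Proof.
move=> a1; pose b (g : gT) : int := (a g : nat)%:Z.
pose x0 : A := \sum_(g in G) gof g *~ b g.
(* The lifted coefficients have sum 1 only modulo m; the defect, a multiple of m, is put on the
   identity. *)
exists (x0 + gof 1%g *~ (1 - aug x0)).
  by rewrite raddfD raddfMz /= aug_gof // intz addrC subrK.
rewrite reduce_mod_grelt; apply: eq_grelt => g Gg; rewrite ffunE gcoefD gcoef_sumz //.
rewrite gcoefMz intrD intrM /b -pmulrn natr_Zp.
have -> : (1 - aug x0)%:~R = 0 :> 'Z_m.
  rewrite intrB /aug rmorph_sum /= (eq_bigr a) => [|h Gh]; last first.
    by rewrite gcoef_sumz // -pmulrn natr_Zp.
  by rewrite a1 subrr.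
by rewrite mulr0 addr0.
Qed.

Lemma Vunits_lift u : u \in Vunits G m -> exists2 x, aug x = 1 & u = unit_of x.
Proof.
rewrite inE => /existsP[a /andP[/eqP/grelt_lift[x ax Dx] /eqP Du]]; exists x => //.
by apply: val_inj; rewrite /unit_of Dx -Du valKd.
Qed.

Lemma Vunits_aug (u : {'GL_#|G|['Z_m]}) x :
  aug x = 1 -> GLval u = reduce_mod x -> u \in Vunits G m.
Proof.
move=> aug1 Du; rewrite inE; apply/existsP; exists [ffun g => (gcoef g x)%:~R].
rewrite Du reduce_mod_grelt eqxx andbT; apply/eqP.
transitivity ((aug x)%:~R : 'Z_m); last by rewrite aug1.
by rewrite /aug rmorph_sum; apply: eq_bigr => g _; rewrite ffunE.
Qed.
End NormalizedUnits.

(** * Normalized units for a prime power modulus *)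

Section PrimePowerUnits.
Variables (gT : finGroupType) (G : {group gT}) (abG : abelian G) (p n e : nat).
Hypotheses (p_pr : prime p) (expG : {in G, forall g, g ^+ (p ^ n) = 1}%g).
Hypothesis e_gt0 : (0 < e)%N.
Local Notation A := (gring abG).
Local Notation gof := (gof abG).
Local Notation q := (p ^ e)%N.
Local Notation unit_of := (unit_of q).

Let q_gt1 : (1 < q)%N.
Proof. by rewrite -[1%N](exp1n e) ltn_exp2r ?prime_gt1. Qed.

(** The p^n-th power is 1 modulo p, and [e.-1] further p-th powers bring this to modulus q. Inverses
    modulo q are therefore powers of [x]. *)
Lemma aug1_expr (x : A) : aug x = 1 -> exists z, x ^+ (p ^ (n + e.-1)) = 1 + q%:R * z.
Proof.
move=> aug1; have [z Dz] := frobenius_aug p_pr x expG.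
have [z' Dz'] := expr_congr_iter e.-1 Dz.
by exists z'; rewrite expnD exprM Dz' aug1 expr1n prednK.
Qed.

Lemma val_unit_of (x : A) : aug x = 1 -> GLval (unit_of x) = reduce_mod q x.
Proof.
move=> aug1; have [z Dz] := aug1_expr aug1.
suff Ux : reduce_mod q x \is a GRing.unit by rewrite /unit_of insubdK.
have E : reduce_mod q (x * x ^+ (p ^ (n + e.-1)).-1) = 1.
  rewrite -exprS (@prednK (p ^ _)) ?expn_gt0 ?prime_gt0 // Dz -(reduce_mod1 abG).
  by apply/reduce_mod_eqP => //; exists z.
apply/unitrP; exists (reduce_mod q (x ^+ (p ^ (n + e.-1)).-1)).
by rewrite -!reduce_modM [X in reduce_mod q X]mulrC.
Qed.

Lemma unit_ofM (x y : A) : aug x = 1 -> aug y = 1 -> unit_of (x * y) = (unit_of x * unit_of y)%g.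
Proof.
move=> ax ay; apply: val_inj; rewrite [LHS]val_unit_of ?rmorphM /= ?ax ?ay //.
by rewrite reduce_modM -!val_unit_of.
Qed.

Lemma unit_of1 : unit_of (1 : A) = 1%g.
Proof. by apply: val_inj; rewrite [LHS]val_unit_of ?rmorph1 // reduce_mod1. Qed.

Lemma aug1X (x : A) k : aug x = 1 -> aug (x ^+ k) = 1.
Proof. by move=> ax; rewrite rmorphXn /= ax expr1n. Qed.

Lemma unit_ofX (x : A) k : aug x = 1 -> unit_of (x ^+ k) = (unit_of x ^+ k)%g.
Proof.
move=> ax; elim: k => [|k IHk]; first by rewrite expr0 unit_of1.
by rewrite exprS expgS unit_ofM ?aug1X // IHk.
Qed.

Lemma unit_of_eqP (x y : A) : aug x = 1 -> aug y = 1 ->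
  unit_of x = unit_of y <-> exists z, x = y + q%:R * z.
Proof.
move=> ax ay; split=> [E | /(reduce_mod_eqP q_gt1) E].
  by apply/(reduce_mod_eqP q_gt1); rewrite -(val_unit_of ax) -(val_unit_of ay) E.
by apply: val_inj; rewrite [LHS](val_unit_of ax) [RHS](val_unit_of ay).
Qed.

Lemma unit_of_in (x : A) : aug x = 1 -> unit_of x \in Vunits G q.
Proof. by move=> ax; apply: (Vunits_aug ax); apply: val_unit_of. Qed.

Lemma Vunits_group_set : group_set (Vunits G q).
Proof.
apply/group_setP; split=> [|u v]; first by rewrite -unit_of1 unit_of_in ?rmorph1.
case/(Vunits_lift abG)=> x ax ->; case/(Vunits_lift abG)=> y ay ->.
by rewrite -unit_ofM // unit_of_in // rmorphM /= ax ay.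
Qed.
Lemma Vunits_abelian : abelian (Vunits G q).
Proof.
apply/centsP=> u Vu v Vv.
case/(Vunits_lift abG): Vu => x ax ->; case/(Vunits_lift abG): Vv => y ay ->.
exact: etrans (esym (unit_ofM ax ay)) (etrans (congr1 unit_of (mulrC x y)) (unit_ofM ay ax)).
Qed.

Lemma GcopyP u : reflect (exists2 g, g \in G & u = unit_of (gof g)) (u \in Gcopy G q).
Proof.
rewrite inE; apply: (iffP existsP) => [[g /andP[Gg /eqP Du]] | [g Gg ->]].
  by exists g => //; apply: val_inj; rewrite [RHS]val_unit_of ?aug_gof // reduce_mod_gof.
by exists g; rewrite Gg /= val_unit_of ?aug_gof // reduce_mod_gof.
Qed.

Lemma unit_of_gof_inj : {in G &, injective (fun g => unit_of (gof g))}.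
Proof.
move=> g h Gg Gh /unit_of_eqP[] => [||z Dz]; rewrite ?aug_gof //.
have /gring_dvdP/(_ g Gg) : exists z, gof g - gof h = q%:R * z.
  by exists z; rewrite Dz addrC addKr.
rewrite gcoefB !gcoef_gof // eqxx; case: eqP => // _.
by rewrite subr0 dvdz1 /= => /eqP q1; move: q_gt1; rewrite q1.
Qed.

Lemma unit_of_gofM : {in G &, {morph (fun g => unit_of (gof g)) : g h / (g * h)%g}}.
Proof. by move=> g h Gg Gh /=; rewrite gofM // unit_ofM ?aug_gof. Qed.
Canonical unit_of_gof_morphism := Morphism unit_of_gofM.

Lemma Gcopy_morphim : Gcopy G q = (unit_of_gof_morphism @* G)%g.
Proof.
apply/setP=> u; rewrite morphimEdom; apply/GcopyP/imsetP => [[g Gg ->] | [g Gg ->]];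
  by exists g.
Qed.

Lemma unit_of_gof_injm : ('injm unit_of_gof_morphism)%g.
Proof. by apply/injmP; apply: unit_of_gof_inj. Qed.
End PrimePowerUnits.

(** * Counting units by conditions on their coefficients *)

Lemma dvdn_val_intr (m d : nat) (k : int) : (1 < m)%N -> (d %| m)%N ->
  (d %| (k%:~R : 'Z_m))%N = (d %| k)%Z.
Proof.
move=> m_gt1 dv_dm; have m_neq0 : m%:Z != 0 by rewrite eqz_nat -lt0n ltnW.
have [r Dr] : exists r : nat, (k %% m)%Z = r.
  by exists `|(k %% m)%Z|%N; rewrite gez0_abs ?modz_ge0.
have lt_rm : (r < m)%N by have := ltz_pmod k (ltnW m_gt1 : 0 < m%:Z); rewrite Dr.
have Dk : k%:~R = r%:R :> 'Z_m.
  rewrite [k](divz_eq k m) Dr intrD intrM -!pmulrn.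
  by have -> : m%:R = 0 :> 'Z_m; rewrite ?mulr0 ?add0r //; apply: pchar_Zp.
rewrite Dk val_Zp_nat // modn_small // [k in RHS](divz_eq k m) Dr rpredDl //.
by rewrite dvdz_mull.
Qed.

Lemma card_dvdn_Zp (m d r : nat) : (1 < m)%N -> (0 < d)%N -> (m = d * r)%N ->
  #|[pred z : 'Z_m | (d %| z)%N]| = r.
Proof.
move=> m_gt1 d_gt0 Dm.
have -> : #|[pred z : 'Z_m | (d %| z)%N]| = (\sum_(0 <= i < m) (d %| i))%N.
  by rewrite -[in RHS](Zp_cast m_gt1) big_mkord -sum1_card big_mkcond; apply: eq_bigr => i _; rewrite inE; case: (d %| i)%N.
have := divn_count_dvd d m; rewrite {1}Dm mulKn // => ->.
rewrite big_ltn ?dvdn0 1?ltnW // [RHS]big_nat_recr ?(ltnW m_gt1) //=.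
by have -> : (d %| m)%N by [rewrite Dm dvdn_mulr]; rewrite addnC.
Qed.

Section CongruenceSets.
Variables (gT : finGroupType) (G : {group gT}) (abG : abelian G) (p n e : nat).
Hypotheses (p_pr : prime p) (expG : {in G, forall g, g ^+ (p ^ n) = 1}%g).
Hypothesis e_gt0 : (0 < e)%N.
Local Notation A := (gring abG).
Local Notation gof := (gof abG).
Local Notation q := (p ^ e)%N.
Local Notation unit_of := (@unit_of gT G abG q).

Let q_gt1 : (1 < q)%N.
Proof. by rewrite -[1%N](exp1n e) ltn_exp2r ?prime_gt1. Qed.

Definition Vcoef (D : gT -> pred 'Z_q) : {set {'GL_#|G|['Z_q]}} :=
  [set u in Vunits G q | [forall (g | g \in G^#%g), D g (mxcoef (GLval u) g)]].

(** The identity coefficient is fixed by the augmentation, and the others are free because every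
    element of augmentation 1 is a unit. *)
Lemma card_Vcoef D : #|Vcoef D| = (\prod_(g in G^#%g) #|D g|)%N.
Proof.
pose f (u : {'GL_#|G|['Z_q]}) : {ffun gT -> 'Z_q} :=
  [ffun g => if g \in G^#%g then mxcoef (GLval u) g else 0].
have sumE (u : {'GL_#|G|['Z_q]}) : u \in Vunits G q ->
    mxcoef (GLval u) 1%g = 1 - \sum_(g in G^#%g) mxcoef (GLval u) g.
  rewrite inE => /existsP[a /andP[/eqP a1 /eqP ->]].
  rewrite -{}a1 mxcoef_grelt // (big_setD1 1%g) //=.
  rewrite [X in _ - X](eq_bigr a) ?addrK // => g /setD1P[_ Gg].
  by rewrite mxcoef_grelt.
have f_inj : {in Vcoef D &, injective f}.
  move=> u v /setIdP[Vu _] /setIdP[Vv _] /ffunP E; apply: val_inj.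
  have Eg g : g \in G^#%g -> mxcoef (GLval u) g = mxcoef (GLval v) g.
    by move=> Gg; have := E g; rewrite !ffunE Gg.
  have E1 : mxcoef (GLval u) 1%g = mxcoef (GLval v) 1%g.
    by rewrite !sumE //; congr (1 - _); apply: eq_bigr.
  move: Vu Vv; rewrite !inE => /existsP[a /andP[_ /eqP Da]] /existsP[b /andP[_ /eqP Db]].
  rewrite [LHS]Da [RHS]Db; apply: eq_grelt => g Gg.
  rewrite -(mxcoef_grelt a Gg) -(mxcoef_grelt b Gg) -Da -Db.
  by have [-> // | g1] := eqVneq g 1%g; rewrite Eg // !inE g1.
rewrite -(card_in_imset f_inj).
have -> : #|f @: Vcoef D| = #|pfamily 0 (mem G^#%g) D|.
  apply: eq_card => a; apply/imsetP/pfamilyP => [[u /setIdP[Vu /forall_inP Du] ->] | [sa Da]].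
    split=> [|g Gg]; last by rewrite ffunE Gg; apply: Du.
    by apply/supportP=> g nGg; rewrite ffunE (negPf nGg).
  pose a' := [ffun g => if g == 1%g then 1 - \sum_(h in G^#%g) a h else a g].
  have a'1 : \sum_(g in G) a' g = 1.
    rewrite (big_setD1 1%g) //= ffunE eqxx [X in _ + X](eq_bigr a) ?subrK // => g.
    by rewrite !inE ffunE => /andP[/negPf->].
  have [x ax Dx] := grelt_lift abG a'1.
  have Du : GLval (unit_of x) = grelt G a' by rewrite (val_unit_of p_pr expG).
  have Ea g : g \in G^#%g -> mxcoef (grelt G a') g = a g.
    by case/setD1P=> g1 Gg; rewrite mxcoef_grelt // ffunE (negPf g1).
  exists (unit_of x).
    rewrite inE (unit_of_in p_pr expG) //=; apply/forall_inP=> g Gg.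
    by rewrite Du Ea //; apply: Da.
  apply/ffunP=> g; rewrite ffunE Du; case: ifP => [/Ea-> // | nGg].
  by have /supportP-> := sa; rewrite ?nGg.
by rewrite card_pfamily foldrE big_image.
Qed.

(** These are the units congruent to 1 modulo p^k; the condition on the identity coefficient follows
    from augmentation 1. *)
Definition congr_units k := Vcoef (fun _ => [pred z : 'Z_q | (p ^ k %| z)%N]).

(** Modulo p these units are supported on G^(p^k); they turn out to be the p^k-th powers modulo
    [congr_units 1]. *)
Definition power_units k :=
  Vcoef (fun g => [pred z : 'Z_q | (g \notin powset G (p ^ k)) ==> (p %| z)%N]).

Lemma mxcoef_unit_of x g : g \in G -> aug x = 1 ->
  mxcoef (GLval (unit_of x)) g = (gcoef g x)%:~R.
Proof.
by move=> Gg ax; rewrite (val_unit_of p_pr expG) // reduce_mod_grelt mxcoef_grelt ?ffunE.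
Qed.

Lemma aug1_gcoef1 (x : A) : aug x = 1 -> gcoef 1%g x = 1 - \sum_(g in G^#%g) gcoef g x.
Proof. by move<-; rewrite /aug (big_setD1 1%g) //= addrK. Qed.

Lemma congr_unitsP x k : (k <= e)%N -> aug x = 1 ->
  unit_of x \in congr_units k <-> exists z, x = 1 + (p ^ k)%:R * z.
Proof.
move=> le_ke ax.
have dvk g : g \in G -> (p ^ k %| mxcoef (GLval (unit_of x)) g)%N = ((p ^ k)%N %| gcoef g x)%Z.
  by move=> Gg; rewrite mxcoef_unit_of // dvdn_val_intr // dvdn_exp2l.
have c1 g : g \in G -> g != 1%g -> gcoef g (1 : A) = 0.
  by move=> Gg /negPf g1; rewrite -(gof1 abG) gcoef_gof // g1.
rewrite inE (unit_of_in p_pr expG) //=; split=> [/forall_inP dv | [z Dx]].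
  have /gring_dvdP[z Dz] : {in G, forall g, ((p ^ k)%N %| gcoef g (x - 1)%R)%Z}.
    move=> g Gg; rewrite gcoefB; have [-> | g1] := eqVneq g 1%g.
      rewrite aug1_gcoef1 // -(gof1 abG) gcoef_gof // eqxx addrAC subrr sub0r rpredN.
      apply: rpred_sum => h G1h; rewrite -dvk; [exact: dv | by case/setD1P: G1h].
    by rewrite c1 // subr0 -dvk //; apply: dv; rewrite !inE g1.
  by exists z; rewrite -Dz addrC subrK.
apply/forall_inP=> g /setD1P[g1 Gg]; rewrite /= dvk // Dx gcoefD c1 // add0r.
by rewrite gcoef_natM natz dvdz_mulr.
Qed.

Lemma power_unitsP x k : aug x = 1 -> unit_of x \in power_units k <->
  {in G, forall g, g \notin powset G (p ^ k) -> (p %| gcoef g x)%Z}.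
Proof.
move=> ax; rewrite inE (unit_of_in p_pr expG) //=.
have dvp g : g \in G -> (p %| mxcoef (GLval (unit_of x)) g)%N = (p %| gcoef g x)%Z.
  by move=> Gg; rewrite mxcoef_unit_of // dvdn_val_intr // dvdn_exp.
split=> [/forall_inP dv g Gg nPg | dv].
  have g1 : g != 1%g.
    apply: contraNneq nPg => ->; apply/imsetP; exists 1%g => //; by rewrite expg1n.
  by rewrite -dvp //; apply: (implyP (dv g _)); rewrite // !inE g1.
apply/forall_inP=> g /setD1P[g1 Gg] /=; apply/implyP=> nPg; rewrite dvp //.
exact: dv.
Qed.

Lemma card_congr_units k : (k <= e)%N ->
  #|congr_units k| = (p ^ ((e - k) * #|G|.-1))%N.
Proof.
move=> le_ke; rewrite card_Vcoef (eq_bigr (fun=> p ^ (e - k)))%N => [|g _].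
  by rewrite prod_nat_const expnM (cardsD1 1%g G) group1.
by apply: card_dvdn_Zp; rewrite // ?expn_gt0 ?prime_gt0 // -expnD subnKC.
Qed.

Lemma card_power_units k :
  #|power_units k| = (p ^ (e.-1 * #|G|.-1 + #|powset G (p ^ k)|.-1))%N.
Proof.
set P := powset G (p ^ k).
have sPG : P \subset G by apply/subsetP=> _ /imsetP[g Gg ->]; apply: groupX.
have P1 : 1%g \in P by apply/imsetP; exists 1%g; rewrite ?expg1n.
rewrite card_Vcoef (bigID (mem P)) /=.
have -> : (\prod_(g in G^#%g | g \in P) #|[pred z : 'Z_q | (g \notin P) ==> (p %| z)%N]|
   = p ^ (e * #|P|.-1))%N.
  rewrite (eq_bigr (fun=> q)) => [|g /andP[_ Pg]]; last first.
    rewrite -[RHS](card_ord q) -[in RHS](Zp_cast q_gt1).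
    by apply: eq_card => z; rewrite !inE Pg.
  rewrite prod_nat_const expnM; congr (_ ^ _)%N.
  rewrite (cardsD1 1%g P) P1 /=; apply: eq_card => g; rewrite [LHS]unfold_in /= !inE.
  by case: (g \in P) (subsetP sPG g) => [/(_ isT)-> | _]; rewrite ?andbT ?andbF.
have -> : (\prod_(g in G^#%g | g \notin P) #|[pred z : 'Z_q | (g \notin P) ==> (p %| z)%N]|
   = p ^ (e.-1 * (#|G| - #|P|)))%N.
  rewrite (eq_bigr (fun=> p ^ e.-1)%N) => [|g /andP[_ nPg]]; last first.
    rewrite -[RHS](card_dvdn_Zp q_gt1 (prime_gt0 p_pr)); last by rewrite -expnS prednK.
    by apply: eq_card => z; rewrite !inE nPg.
  rewrite prod_nat_const expnM; congr (_ ^ _)%N.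
  rewrite -(cardsDS sPG) -sum1_card -[RHS]sum1_card; apply: eq_bigl => g.
  rewrite [LHS]unfold_in /= !inE; have [->|_] := eqVneq g 1%g; first by rewrite P1.
  by rewrite andbC.
rewrite -expnD; congr (_ ^ _)%N.
have := subset_leq_card sPG; have : (0 < #|P|)%N by apply/card_gt0P; exists 1%g.
case: #|P| #|G| e_gt0 => [|i] [|j] //; case: (e) => // e' _ _ /=.
rewrite ltnS subSS => le_ij; rewrite -{2}(subnKC le_ij); nia.
Qed.
End CongruenceSets.

(** * The groups V, B and U, and the rank of a complement *)

Section UnitGroupStructure.
Variables (gT : finGroupType) (G : {group gT}) (abG : abelian G) (p n e : nat).
Hypotheses (p_pr : prime p) (expG : {in G, forall g, g ^+ (p ^ n) = 1}%g).
Hypothesis e_gt0 : (0 < e)%N.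
Local Notation A := (gring abG).
Local Notation gof := (gof abG).
Local Notation q := (p ^ e)%N.
Local Notation unit_of := (@unit_of gT G abG q).
Local Notation U k := (congr_units G p e k).

Let q_gt1 : (1 < q)%N.
Proof. by rewrite -[1%N](exp1n e) ltn_exp2r ?prime_gt1. Qed.

Let unit_ofM := @unit_ofM gT G abG p n e p_pr expG e_gt0.
Let unit_ofX := @unit_ofX gT G abG p n e p_pr expG e_gt0.
Let unit_of_in := @unit_of_in gT G abG p n e p_pr expG e_gt0.
Let congrP := @congr_unitsP gT G abG p n e p_pr expG e_gt0.

Canonical Vunits_group := Group (Vunits_group_set abG p_pr expG e_gt0).
Local Notation V := Vunits_group.

Definition Gcopy_group := (unit_of_gof_morphism abG p_pr expG e_gt0 @* G)%G.
Local Notation B := Gcopy_group.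

Lemma Gcopy_groupP u : reflect (exists2 g, g \in G & u = unit_of (gof g)) (u \in B).
Proof. by rewrite /= -Gcopy_morphim; apply: (GcopyP abG p_pr expG e_gt0). Qed.

Lemma unit_of_inv (x : A) : aug x = 1 -> exists y,
  [/\ aug y = 1, unit_of y = (unit_of x)^-1%g & exists z, x * y = 1 + q%:R * z].
Proof.
move=> ax; have [z Dz] := aug1_expr p_pr expG e_gt0 ax.
have E : x * x ^+ (p ^ (n + e.-1)).-1 = 1 + q%:R * z.
  by rewrite -exprS (@prednK (p ^ _)) ?expn_gt0 ?prime_gt0.
have ay := aug1X (p ^ (n + e.-1)).-1 ax; exists (x ^+ (p ^ (n + e.-1)).-1); split=> //.
  apply: (mulgI (unit_of x)); rewrite mulgV; apply: etrans (esym (unit_ofM ax ay)) _.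
  apply: etrans (unit_of1 abG p_pr expG e_gt0).
  apply/(unit_of_eqP p_pr expG e_gt0); last by exists z.
    by rewrite rmorphM /= ax ay.
  exact: rmorph1.
by exists z.
Qed.

Lemma congr_cosetP (x y : A) : aug x = 1 -> aug y = 1 ->
  ((unit_of x)^-1 * unit_of y)%g \in U 1 <-> exists z, y = x + p%:R * z.
Proof.
move=> ax ay; have [x' [ax' <- [z0 Dz0]]] := unit_of_inv ax.
have [d Dq] : exists d, q = (p * d)%N by exists (p ^ e.-1)%N; rewrite -expnS prednK.
rewrite -(unit_ofM ax' ay) congrP ?rmorphM /= ?ax' ?ay // expn1.
split=> [[z Dz] | [z Dy]].
  exists (x * z - d%:R * z0 * y); transitivity (x * (x' * y) - q%:R * z0 * y).
    by rewrite mulrA Dz0; ring.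
  by rewrite Dz Dq natrM; ring.
exists (d%:R * z0 + x' * z); transitivity (x * x' + p%:R * (x' * z)).
  by rewrite Dy; ring.
by rewrite Dz0 Dq natrM; ring.
Qed.

Lemma congr_units_subV k : U k \subset V.
Proof. by apply/subsetP=> u /setIdP[]. Qed.

Lemma congr_units_group_set : group_set (U 1).
Proof.
apply/group_setP; split=> [|u v Uu Uv].
  rewrite -(unit_of1 abG p_pr expG e_gt0); apply/congrP; rewrite ?rmorph1 //.
  by exists 0; rewrite mulr0 addr0.
have Vu := subsetP (congr_units_subV 1) u Uu; have Vv := subsetP (congr_units_subV 1) v Uv.
move: Uu Uv; have [x ax ->] := Vunits_lift abG Vu; have [y ay ->] := Vunits_lift abG Vv.
case/congrP=> // z Dz; case/congrP=> // z' Dz'.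
rewrite -(unit_ofM ax ay); apply/congrP; rewrite ?rmorphM /= ?ax ?ay //.
by exists (z + z' + (p ^ 1)%:R * z * z'); rewrite Dz Dz'; ring.
Qed.
Definition congr1_group := Group congr_units_group_set.

Lemma Vunits_group_abelian : abelian V.
Proof. exact: Vunits_abelian p_pr expG e_gt0. Qed.

Lemma card_Vunits_group : #|V| = (p ^ (e * #|G|.-1))%N.
Proof.
(* The congruence modulo p^0 is void, so the whole group is the congruence set of level 0. *)
rewrite -[e in RHS]subn0 -(card_congr_units abG p_pr expG e_gt0 (leq0n e)).
apply: eq_card => u; rewrite [RHS]inE; case: (u \in _) => //=.
by apply/esym/forall_inP=> g _; rewrite /= dvd1n.
Qed.

Lemma Vunits_group_pgroup : (p.-group V)%g.
Proof. by rewrite /pgroup card_Vunits_group pnatX pnat_id. Qed.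

Lemma Gcopy_group_sub : B \subset V.
Proof. by apply/subsetP=> _ /Gcopy_groupP[g Gg ->]; apply: unit_of_in; rewrite aug_gof. Qed.

Lemma dvdz_one_prime : (p %| 1)%Z = false.
Proof. by rewrite dvdz1 absz_nat; apply/negbTE; rewrite neq_ltn prime_gt1 ?orbT. Qed.

Lemma Gcopy_TI_congr1 : (B :&: congr1_group = 1)%g.
Proof.
apply/trivgP/subsetP=> _ /setIP[/Gcopy_groupP[g Gg ->]] /(congrP e_gt0 (aug_gof abG Gg))[z Dz].
have [-> | g1] := eqVneq g 1%g; first by apply/set1gP; rewrite gof1; apply: unit_of1 p_pr expG e_gt0.
have := congr1 (gcoef g) Dz; rewrite gcoefD gcoef_natM -(gof1 abG) !gcoef_gof // eqxx (negPf g1).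
rewrite add0r expn1 [p%:R]natz => E; have := dvdz_mulr (gcoef g z) (dvdzz p).
by rewrite -E dvdz_one_prime.
Qed.

(** By the Frobenius identity, a p^k-th power is supported modulo p on G^(p^k). *)
Lemma gcoef_exprp (x : A) k g : g \in G -> g \notin powset G (p ^ k) ->
  (p %| gcoef g (x ^+ (p ^ k)))%Z.
Proof.
move=> Gg nPg; have [z ->] := frobenius p_pr k x.
rewrite gcoefD gcoef_sum big1 => [|h Gh]; first by rewrite add0r gcoef_natM natz dvdz_mulr.
rewrite gcoefMz gcoef_gof ?groupX //; case: eqP => [Dg | _]; last by rewrite mul0r.
by case/imsetP: nPg; exists h.
Qed.

(** If the power of [v] agrees with g modulo p, its coefficient at g is not divisible by p, so g
    lies in G^(p^k) and a root of g serves as [b]. *)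
Lemma Gcopy_pure k v : v \in V -> (v ^+ (p ^ k))%g \in (B * congr1_group)%g ->
  exists2 b, b \in B & (b^-1 ^+ (p ^ k) * v ^+ (p ^ k))%g \in congr1_group.
Proof.
move=> Vv; have [x ax ->] := Vunits_lift abG Vv; rewrite -(unit_ofX _ ax) => /mulsgP[_ u /Gcopy_groupP[g Gg ->] Uu].
have axk := aug1X (p ^ k) ax; have ag := aug_gof abG Gg.
move/(canLR (mulKg _)) => Du; rewrite -{}Du in Uu.
have [z Dz] := (congr_cosetP ag axk).1 Uu.
have /imsetP[h Gh Dg] : g \in powset G (p ^ k).
  apply/negPn/negP=> /(gcoef_exprp x Gg).
  rewrite Dz gcoefD gcoef_gof // eqxx gcoef_natM rpredDr ?dvdz_one_prime //.
  by rewrite natz dvdz_mulr.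
exists (unit_of (gof h)); first by apply/Gcopy_groupP; exists h.
rewrite expgVn; suff <- : unit_of (gof g) = (unit_of (gof h) ^+ (p ^ k))%g by [].
by rewrite -(unit_ofX _ (aug_gof abG Gh)) Dg (gofX abG _ Gh).
Qed.

Lemma congr1_group_exponent : {in congr1_group, forall u, u ^+ (p ^ e.-1) = 1}%g.
Proof.
move=> u Uu; have Vu := subsetP (congr_units_subV 1) u Uu.
move: Uu; have [x ax ->] := Vunits_lift abG Vu; case/congrP=> // z; rewrite expn1 => Dz.
have [z' Dz'] := expr_congr_iter e.-1 Dz.
rewrite -(unit_ofX _ ax) -(unit_of1 abG p_pr expG e_gt0).
apply/(unit_of_eqP p_pr expG e_gt0); rewrite ?rmorph1 ?aug1X //.
by exists z'; rewrite Dz' expr1n prednK.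
Qed.

Lemma card_congr1_group : #|congr1_group| = (p ^ (e.-1 * #|G|.-1))%N.
Proof. by rewrite -subn1 (card_congr_units abG p_pr expG e_gt0). Qed.

Lemma power_units_cosets k t : t \in power_units G p e k <->
  t \in V /\ exists2 v, v \in V & ((v ^+ (p ^ k))^-1 * t)%g \in congr1_group.
Proof.
split=> [Tt | [Vt [v Vv]]]; last first.
  have [x ax ->] := Vunits_lift abG Vv; have [y ay ->] := Vunits_lift abG Vt.
  rewrite -(unit_ofX _ ax) => /(congr_cosetP (aug1X _ ax) ay)[z Dy].
  apply/(power_unitsP p_pr expG e_gt0) => // g Gg nPg.
  by rewrite Dy gcoefD rpredDl ?gcoef_exprp // gcoef_natM natz dvdz_mulr.
have Vt : t \in V by case/setIdP: Tt.
split=> //; move: Tt; have [x ax ->] := Vunits_lift abG Vt.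
move/(power_unitsP p_pr expG e_gt0) => /(_ ax) dvx.
(* A p^k-th root modulo p is obtained by replacing each h in G^(p^k) by a root of
   it; the multiple of p added to the constant term restores augmentation 1. *)
pose r h := odflt 1%g [pick g in G | (g ^+ (p ^ k))%g == h].
pose P := powset G (p ^ k).
have sPG : P \subset G by apply/subsetP=> _ /imsetP[g Gg ->]; apply: groupX.
have rP h : h \in P -> r h \in G /\ (r h ^+ (p ^ k))%g = h.
  case/imsetP=> g Gg ->; rewrite /r; case: pickP => [g' /andP[Gg' /eqP] // | /(_ g)].
  by rewrite Gg eqxx.
pose y0 : A := \sum_(h in P) gof (r h) *~ gcoef h x.
have [c Dc] : exists c : int, 1 - aug y0 = p%:Z * c.
  suff /dvdzP[c ->] : (p %| 1 - aug y0)%Z by exists c; rewrite mulrC.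
  have -> : aug y0 = \sum_(h in P) gcoef h x.
    rewrite raddf_sum; apply: eq_bigr => h Ph; have [Gr _] := rP h Ph.
    by rewrite raddfMz /= aug_gof // intz.
  rewrite -ax /aug (big_setID P) (setIidPr sPG) /= addrAC subrr add0r.
  by apply: rpred_sum => h /setDP[Gh nPh]; apply: dvx.
pose y : A := y0 + (p%:Z * c)%:~R.
have ay : aug y = 1 by rewrite raddfD /= rmorph_int intz -Dc addrC subrK.
exists (unit_of y); first exact: unit_of_in.
rewrite -(unit_ofX _ ay); apply/(congr_cosetP (aug1X _ ay) ax).
have [z1 Dz1] : exists z1 : A, x = adams (p ^ k) y0 + p%:R * z1.
  rewrite /y0 adams_sumz => [|h /rP[]//].
  rewrite (eq_bigr (fun h => gof h *~ gcoef h x)) => [|h /rP[_ ->]//].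
  have [z1 Dz1] : exists z1 : A, \sum_(h in G :\: P) gof h *~ gcoef h x = p%:R * z1.
    apply: (big_rec (fun f => exists z1 : A, f = p%:R * z1)); first by exists 0; rewrite mulr0.
    move=> h _ /setDP[Gh nPh] [z1 ->]; have /dvdzP[a ->] := dvx h Gh nPh.
    by exists (gof h *~ a + z1); rewrite mulrDr; congr (_ + _); rewrite mulrzA -pmulrn mulr_natl.
  by exists z1; rewrite {1}(gringE x) (big_setID P) (setIidPr sPG) /= Dz1.
have [z2 Dz2] := frobenius p_pr k y0.
have [z3 Dz3] : exists z3, y ^+ (p ^ k) = y0 ^+ (p ^ k) + (p ^ k.+1)%:R * z3.
  apply: (expr_congr_iter (z := c%:~R)).
  by rewrite /y intrM -pmulrn.
exists (z1 - z2 - (p ^ k)%:R * z3); rewrite Dz3 Dz2 {1}Dz1 expnS natrM; ring.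
Qed.

(** For e > 1, every element of [L] of order dividing p is shown to be 1 modulo p^(e-1), and the
    number of such units is the bound. For e = 1 the bound is the order of [V]. *)
Lemma card_Ohm1_complement (L : {group {'GL_#|G|['Z_q]}}) :
  (B \x L = V)%g -> congr1_group \subset L -> (#|'Ohm_1(L)%g| <= p ^ #|G|.-1)%N.
Proof.
move=> DV sUL; have [_ _ _ tiBL] := dprodP DV.
have sLV : L \subset V by have /dprodW/mulG_sub[] := DV.
have [e1 | e_gt1] := eqVneq e 1%N.
  apply: leq_trans (subset_leq_card (subset_trans (Ohm_sub 1 L) sLV)) _.
  by rewrite card_Vunits_group e1 mul1n.
have {}e_gt1 : (1 < e)%N by rewrite ltn_neqAle eq_sym e_gt1.
have Ee : (e - e.-1 = 1)%N by rewrite -subn1 subKn.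
have := card_congr_units abG p_pr expG e_gt0 (leq_pred e); rewrite Ee mul1n => <-.
apply: subset_leq_card; apply/subsetP=> u.
rewrite (OhmEabelian (pgroupS sLV Vunits_group_pgroup)); last first.
  exact: abelianS (Ohm_sub _ _) (abelianS sLV Vunits_group_abelian).
case/LdivP=> Lu; rewrite expn1 => up1; have Vu := subsetP sLV u Lu.
move: Lu up1; have [x ax ->] := Vunits_lift abG Vu => Lx.
rewrite -(unit_ofX _ ax) -(unit_of1 abG p_pr expG e_gt0).
case/(unit_of_eqP p_pr expG e_gt0); rewrite ?rmorph1 ?aug1X // => z Dz.
have [i Di] : exists i, e = i.+2 by exists e.-2; case: (e) e_gt1 => [|[]].
have [g Gg [z1 Dx]] : exists2 g, g \in G & exists z, x = gof g + p%:R * z.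
  apply: (torsion_mod_p2 p_pr expG ax (z1 := (p ^ i)%:R * z)).
  by rewrite Dz Di !expnS !natrM; ring.
(* The group element found modulo p lies in [L], since [U] does, and therefore in [B :&: L]; so it
   is trivial. *)
have Ux : unit_of x \in congr1_group.
  have Bg : unit_of (gof g) \in B by apply/Gcopy_groupP; exists g.
  have Ugx : ((unit_of (gof g))^-1 * unit_of x)%g \in congr1_group.
    by apply/congr_cosetP; rewrite ?aug_gof //; exists z1.
  have : unit_of (gof g) \in (B :&: L)%g.
    by rewrite inE Bg -groupV -(groupMr _ Lx) (subsetP sUL).
  by rewrite tiBL => /set1gP g1; move: Ugx; rewrite g1 invg1 mul1g.
(* The congruence to 1 is improved one power of p at a time, up to p^(e-1). *)
suff Uk k : (0 < k < e)%N -> unit_of x \in U k by apply: Uk; rewrite Di /= ltnSn.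
elim: k => // k IHk; have [-> // | k_gt0] := posnP k.
case/andP=> _ lt_ke; have le_ke := ltnW (ltnW lt_ke).
have /(congrP le_ke ax)[z2 Dz2] : unit_of x \in U k by apply: IHk; rewrite k_gt0 ltnW.
apply/(congrP (ltnW lt_ke) ax).
have [z3 Dz3] : exists z', z2 = p%:R * z'.
  by apply: (torsion_congruence_unit p_pr expG k_gt0 lt_ke (z := z)); rewrite -Dz2.
by exists z3; rewrite Dz2 Dz3 expnSr natrM; ring.
Qed.
End UnitGroupStructure.

Local Close Scope ring_scope.

(** * Invariants *)

Lemma count_mem_tally (T : eqType) (s ys : seq T) v : uniq s ->
  count_mem v (flatten [seq nseq (count_mem x ys) x | x <- s]) =
    if v \in s then count_mem v ys else 0.
Proof.
elim: s => //= x s IHs /andP[nsx /IHs IH]; rewrite count_cat count_nseq IH /= inE.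
by have [-> | neq] := eqVneq v x; rewrite ?(negPf nsx) ?mul1n ?addn0.
Qed.

(** This groups the exponents of the cyclic factors by value, as in the list of invariants. *)
Lemma perm_tally_superset (T : eqType) (s ys : seq T) : uniq s -> {subset ys <= s} ->
  perm_eq ys (flatten [seq nseq (count_mem x ys) x | x <- s]).
Proof.
move=> Us sys; apply/allP=> v _ /=; rewrite count_mem_tally //.
case: ifP => // nsv; rewrite eqn0Ngt -has_count has_pred1; apply/negP=> /sys.
by rewrite nsv.
Qed.

Lemma count_gt_split (T : Type) (f : T -> nat) k (s : seq T) :
  count (fun x => k < f x) s = count (fun x => f x == k.+1) s + count (fun x => k.+1 < f x) s.
Proof.
elim: s => //= x s ->; have [->|] := eqVneq (f x) k.+1; first by rewrite ltnn ltnSn; lia.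
by move=> neq; have -> : (k < f x) = (k.+1 < f x); [rewrite [RHS]ltn_neqAle eq_sym neq | lia].
Qed.

Theorem theorem2 (p e n : nat) (gT : finGroupType) (G : {group gT}) :
  prime p -> 0 < e -> abelian G -> (p.-group G)%g -> exponent G = p ^ n ->
  exists (L : {group {'GL_#|G|['Z_(p ^ e)]}})
         (xs : seq {'GL_#|G|['Z_(p ^ e)]}) (s : nat -> nat) (l : nat),
  [/\ Vunits G (p ^ e) = (Gcopy G (p ^ e) \x L)%g,
      (L : {set _}) = (\big[dprod/1]_(x <- xs) <[x]>)%g,
      (forall i, 1 <= i <= n ->
         Posz (s i) = (Posz #|powset G (p ^ i.-1)%N| - Posz #|powset G (p ^ i)%N| *+ 2
                       + Posz #|powset G (p ^ i.+1)%N|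
                       - Posz (count_mem (p ^ i)%N (abelian_type G)))%R),
      Posz l = (Posz #|G| - 1 - Posz (\sum_(1 <= i < n.+1) s i))%R
    & perm_eq [seq #[x]%g | x <- xs]
        (nseq l (p ^ e.-1) ++ flatten [seq nseq (s i) (p ^ (i + e.-1)) | i <- iota 1 n])].
Proof.
move=> p_pr e_gt0 abG pG exG.
have expG : {in G, forall g, g ^+ (p ^ n) = 1}%g by move=> g Gg; rewrite -exG expg_exponent.
pose V := Vunits_group abG p_pr expG e_gt0.
pose B := Gcopy_group abG p_pr expG e_gt0.
pose U := congr1_group abG p_pr expG e_gt0.
have abV : abelian V := Vunits_group_abelian abG p_pr expG e_gt0.
have pV : (p.-group V)%g := Vunits_group_pgroup abG p_pr expG e_gt0.
have sBV : B \subset V := Gcopy_group_sub abG p_pr expG e_gt0.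
have sUV : U \subset V by apply: congr_units_subV.
have [L [DV sUL]] := pure_mod_complement abV pV sBV sUV
  (Gcopy_TI_congr1 abG p_pr expG e_gt0) (@Gcopy_pure _ _ abG _ _ _ p_pr expG e_gt0).
have sLV : L \subset V by have /dprodW/mulG_sub[] := DV.
have abL := abelianS sLV abV; have pL := pgroupS sLV pV.
set N := #|G|.-1; set d := e.-1.
have [xs [DL size_xs le_d countM]] := homocyclic_structure p_pr abL pL sUL
  (card_congr1_group abG p_pr expG e_gt0) (@congr1_group_exponent _ _ abG _ _ _ p_pr expG e_gt0)
  (card_Ohm1_complement DV sUL).
pose f (x : {'GL_#|G|['Z_(p ^ e)]}) := logn p #[x]%g.
(* [C] counts the factors of [L] of order above p^(d+k), which are those of [L / U] of order above
   p^k; [F] and [T] play for [G] the roles of [M] and [C]. *)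
pose C k := count (fun x => d + k < f x) xs.
pose M k := logn p #|'Mho^k(L / U)%g|.
pose F k := logn p #|'Mho^k(G)%g|.
pose T k := count (fun m => k < logn p m) (abelian_type G).
have MC k : M k = C k + M k.+1 by apply: countM.
have FT k : F k = T k + F k.+1 by apply: count_logn_abelian_type.
(* The two counts of [power_units], by coefficients and as a preimage of ['Mho^k(V / U)], are
   equated. *)
have PE k : #|powset G (p ^ k)| = (F k + M k).+1.
  have P_gt0 : 0 < #|powset G (p ^ k)|.
    by apply/card_gt0P; exists 1%g; apply/imsetP; exists 1%g; rewrite ?expg1n.
  have := card_Mho_quotient abV pV sUV (@power_units_cosets _ _ abG _ _ _ p_pr expG e_gt0 k).
  rewrite (split_Mho_quotient abV sBV sUV (Gcopy_TI_congr1 abG p_pr expG e_gt0) k DV sUL).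
  rewrite (card_power_units abG p_pr expG e_gt0) -/N (card_congr1_group abG p_pr expG e_gt0) expnD => /eqP.
  rewrite eqn_pmul2l ?expn_gt0 ?prime_gt0 // => /eqP/(congr1 (logn p)).
  rewrite pfactorK // lognM ?cardG_gt0 // -/(M k) => E.
  have -> : F k = logn p #|'Mho^k(B)%g|.
    congr (logn p _); apply: card_isog; apply: isog_Mho.
    by apply: sub_isog; rewrite ?unit_of_gof_injm.
  by rewrite -E prednK.
(* G^(p^n) is trivial, so no cyclic factor of [L / U] has order above p^n. *)
have Mn : M n = 0.
  have P1 : #|powset G (p ^ n)| <= 1.
    rewrite -(cards1 (1%g : gT)); apply: subset_leq_card; apply/subsetP=> _ /imsetP[g Gg ->].
    by rewrite expG // set11.
  by move: P1; rewrite PE ltnS leqn0 addn_eq0 => /andP[_ /eqP].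
(* The value at 0 is the multiplicity l of the factors of order p^(e-1). *)
pose s i := count (fun x => f x == d + i) xs.
have CS k : C k = s k.+1 + C k.+1 by rewrite /C count_gt_split /s addnS.
have C0 k : C 0 = \sum_(1 <= i < k.+1) s i + C k.
  elim: k => [|k IHk]; first by rewrite big_geq.
  by rewrite big_nat_recr //= -addnA -CS.
have Cn : C n = 0 by apply/eqP; have /esym/eqP := MC n; rewrite Mn addn_eq0 => /andP[].
have xs_p x : x \in xs -> #[x]%g = p ^ f x.
  move=> xsx; apply: card_pgroup; apply: mem_p_elt pL _.
  have := bigdprodWY DL; rewrite (big_rem x) //= => <-.
  by rewrite mem_gen // inE cycle_id.
have size_N : N = s 0 + C 0.
  rewrite /s /C !addn0 -[N]size_xs -(count_predC (fun x => f x == d)); congr (_ + _).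
  apply: eq_in_count => x xsx /=; rewrite ltn_neqAle eq_sym; have -> // : d <= f x by apply: le_d.
  by rewrite andbT.
exists L, xs, s, (s 0); split=> //.
- by rewrite (Gcopy_morphim abG p_pr expG e_gt0); apply: esym DV.
(* By [PE], second differences of the orders of the groups G^(p^k) are second differences of
   [F + M]. Those of [F] give the t_i and those of [M] the s_i. *)
- move=> [//|i] _.
  have Dt : count_mem (p ^ i.+1) (abelian_type G) = count (fun m => logn p m == i.+1) (abelian_type G).
    have [b Db <-] := abelian_structure abG; rewrite !count_map; apply: eq_in_count => x bx /=.
    have px : p.-elt%g x.
      apply: mem_p_elt pG _; have := bigdprodWY Db; rewrite (big_rem x) //= => <-.
      by rewrite mem_gen // inE cycle_id.
    by rewrite /order (card_pgroup px) pfactorK // eqn_exp2l ?prime_gt1.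
  have TS : T i = count_mem (p ^ i.+1) (abelian_type G) + T i.+1.
    by rewrite Dt /T count_gt_split.
  rewrite /= !PE.
  move: (MC i) (MC i.+1) (FT i) (FT i.+1) (CS i); rewrite TS.
  move: (count_mem _ _) (M i) (M i.+1) (M i.+2) (F i) (F i.+1) (F i.+2) => t a b c u v w.
  by move: (C i) (C i.+1) (s i.+1) (T i.+1) => x y z r; clear; lia.
- move: size_N (cardG_gt0 G); rewrite (C0 n) Cn addn0 /N; move: #|G| (s 0) (\sum_(_ <= i < _) _).
  by clear; lia.
have -> : [seq #[x]%g | x <- xs] = [seq p ^ i | i <- [seq f x | x <- xs]].
  by rewrite -map_comp; apply/eq_in_map => x /xs_p.
have -> : nseq (s 0) (p ^ d) ++ flatten [seq nseq (s i) (p ^ (i + d)) | i <- iota 1 n]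
  = [seq p ^ i | i <- flatten [seq nseq (count_mem x [seq f y | y <- xs]) x | x <- iota d n.+1]].
  rewrite map_flatten /= map_nseq; congr (nseq _ _ ++ _).
    by rewrite count_map /s; apply: eq_count => x /=; rewrite addn0.
  rewrite -[d.+1]addn1 iotaDl -!map_comp; congr flatten; apply: eq_map => i /=.
  by rewrite map_nseq count_map addnC; congr nseq; apply: eq_count => x /=.
apply: perm_map; apply: perm_tally_superset; first exact: iota_uniq.
(* All exponents lie between [d] and [d + n]: the lower bound is [le_d], and [Cn] excludes anything
   larger. *)
move=> _ /mapP[x xsx ->]; rewrite mem_iota; apply/andP; split; first exact: le_d.
rewrite addnS ltnS leqNgt; apply/negP=> lt_x.
have : 0 < C n by rewrite -has_count; apply/hasP; exists x.
by rewrite Cn.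
Qed.
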